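(* For all $\lambda\in[0,1]$ and all $t>0$, the image of the symmetric Cauchy law $\frac1\pi\frac{t\,dx}{x^2+t^2}$ with parameter $t$ by the rectangular Bercovici–Pata bijection with ratio $\lambda$ is the probability measure $$1_{\mathbb{R}\setminus\left[-\frac{t(1-\lambda)}2,\frac{t(1-\lambda)}2\right]}(x)\,\frac{t}{\pi(\lambda t^2+x^2)}\left[1-\frac{t^2(\lambda-1)^2}{4x^2}\right]^{1/2}dx .$$ Its support is $\mathbb{R}\setminus\left(-\frac{t(1-\lambda)}2,\frac{t(1-\lambda)}2\right)$.
   Context: A symmetric probability measure $\mu$ on $\mathbb{R}$ is $*$-infinitely divisible (for classical convolution $*$) iff there is a (unique) symmetric positive finite measure $G$, called its Lévy measure, with $\int e^{is\xi}d\mu(s)=\exp\left(\int_{\mathbb{R}}(\cos(s\xi)-1)\frac{1+s^2}{s^2}\,dG(s)\right)$ for all $\xi\in\mathbb{R}$ (the integrand being $-\xi^2/2$ at $s=0$). The symmetric Cauchy law with parameter $t$ has Lévy measure $\frac{t}{\pi}\frac{dx}{1+x^2}$. Rectangular $R$-transform with ratio $\lambda\in[0,1]$. Let $z\mapsto\sqrt z$ be the analytic square root on $\mathbb{C}\setminus[0,+\infty)$ with $\sqrt{-1}=i$, and $z\mapsto z^{1/2}$ the analytic square root on $\mathbb{C}\setminus(-\infty,0]$ with $1^{1/2}=1$; $\arg$ takes values in $[0,2\pi)$. For $\alpha\in(0,\pi)$, $\beta>0$ let $\Delta_{\alpha,\beta}=\{z: |\arg z-\pi|<\alpha,\ 0<|z|<\beta\}$.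 For a symmetric probability measure $\mu$ let $G_\mu(z)=\int\frac{d\mu(t)}{z-t}$ and, for $z\in\mathbb{C}\setminus[0,+\infty)$, $H_\mu(z)=\lambda\, G_\mu(1/\sqrt z)^2+(1-\lambda)\sqrt z\,G_\mu(1/\sqrt z)$. There is a (unique germ of) analytic function $H_\mu^{-1}$, defined for every $\alpha\in(0,\pi)$ on $\Delta_{\alpha,\beta}$ for some $\beta>0$, with $H_\mu^{-1}(z)/z\to1$ as $z\to0$ in $\{|\arg z-\pi|<\alpha\}$ and $H_\mu\circ H_\mu^{-1}=H_\mu^{-1}\circ H_\mu=\mathrm{id}$ on such a $\Delta_{\alpha,\beta}$. Near $0$ let $U(z)=\frac{-\lambda-1+[(\lambda+1)^2+4\lambda z]^{1/2}}{2\lambda}$ ($U(z)=z$ if $\lambda=0$). Then $C_\mu(z)=U\!\left(\frac{z}{H_\mu^{-1}(z)}-1\right)$. The map $\mu\mapsto C_\mu$ is injective. The rectangular free convolution $\mu\boxplus_\lambda\nu$ of symmetric probability measures is the unique symmetric probability measure with $C_{\mu\boxplus_\lambda\nu}=C_\mu+C_\nu$. A symmetric probability measure is $\boxplus_\lambda$-infinitely divisible if for each $n\ge1$ it is the $n$-fold $\boxplus_\lambda$-power of some symmetric probability measure. The formula $C_\mu(z)=z\int_{\mathbb{R}}\frac{1+s^2}{1-zs^2}\,dG(s)$ gives a bijection between $\boxplus_\lambda$-infinitely divisible distributions $\mu$ and symmetric positive finite measures $G$ (the Lévy measure of $\mu$). The rectangular Bercovici–Pata bijection with ratio $\lambda$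 maps a symmetric $*$-infinitely divisible distribution to the $\boxplus_\lambda$-infinitely divisible distribution with the same Lévy measure. *)

(* Defs.v *)
From HB Require Import structures.
From mathcomp Require Import all_boot all_order all_algebra.
From mathcomp Require Import complex.
From mathcomp Require Import all_classical all_reals all_analysis.

Set Implicit Arguments.
Unset Strict Implicit.
Unset Printing Implicit Defensive.

Import Order.TTheory GRing.Theory Num.Theory.
Import numFieldNormedType.Exports.

Local Open Scope classical_set_scope.
Local Open Scope ring_scope.
Local Open Scope complex_scope.

Notation realLaw R := (probability (measurableTypeR R) R).
Notation finiteMeasureR R := {finite_measure set (measurableTypeR R) -> \bar R}.

Section Measures.
Variable R : realType.
Implicit Types (mu : {measure set (measurableTypeR R) -> \bar R}).

Definition symmetric_measure mu : Prop :=
  forall A : set (measurableTypeR R), measurable A ->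
    mu ((fun x : R => - x) @^-1` A) = mu A.

Definition has_density mu (f : R -> R) : Prop :=
  forall A : set (measurableTypeR R), measurable A ->
    mu A = (\int[@lebesgue_measure R]_(x in A) (f x)%:E)%E.

Definition measure_support mu : set R :=
  [set x | forall V : set R, open V -> V x -> (0 < mu V)%E].

Definition Cintegral mu (f : R -> R[i]) : R[i] :=
  (\int[mu]_x complex.Re (f x)) +i* (\int[mu]_x complex.Im (f x)).

End Measures.

Section ClassicalLevy.
Variable R : realType.
Implicit Types (mu : realLaw R) (G : finiteMeasureR R).

Definition char_fun mu (xi : R) : R[i] :=
  Cintegral mu (fun s => cos (s * xi) +i* sin (s * xi)).

Definition levy_kernel (xi s : R) : R :=
  if s == 0 then - (xi ^+ 2 / 2)
  else (cos (s * xi) - 1) * ((1 + s ^+ 2) / s ^+ 2).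

(* A symmetric law is infinitely divisible for classical convolution iff it has
   such a measure G, which is then unique (Levy-Khintchine). *)
Definition is_levy_measure mu G : Prop :=
  [/\ symmetric_measure mu, symmetric_measure G &
   forall xi : R, char_fun mu xi = (expR (\int[G]_s levy_kernel xi s))%:C].

End ClassicalLevy.

Section ComplexPlane.
Variable R : realType.
Implicit Types (z : R[i]) (alpha beta : R).

Definition Cabs z : R := complex.Re `|z|.

(* Argument in [0, 2 pi) of a nonzero complex number. *)
Definition Carg z : R :=
  let a := acos (complex.Re z / Cabs z) in
  if 0 <= complex.Im z then a else 2 * pi - a.

(* The library's [sqrtc] is the principal root: nonnegative real part, analytic
   off the negative reals, [sqrtc 1 = 1].  The branch below is analytic off
   [0, +oo) and maps -1 to i. *)
Definition sqrt_up z : R[i] := (0 +i* 1) * sqrtc (- z).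

Definition cone alpha : set R[i] :=
  [set z | z != 0 /\ `|Carg z - pi| < alpha].

Definition sector alpha beta : set R[i] :=
  [set z | `|Carg z - pi| < alpha /\ 0 < Cabs z < beta].

(* Equality of germs at 0, on sectors avoiding the positive half-line. *)
Definition germ_eq (f g : R[i] -> R[i]) : Prop :=
  forall alpha, 0 < alpha < pi ->
    exists2 beta, 0 < beta & forall z, sector alpha beta z -> f z = g z.

End ComplexPlane.

Section RectangularTransform.
Variable R : realType.
Variable lambda : R.
Implicit Types (mu nu rho : realLaw R).

Definition cauchy_transform mu (z : R[i]) : R[i] :=
  Cintegral mu (fun s => (z - s%:C)^-1).

Definition Hrect mu (z : R[i]) : R[i] :=
  let g := cauchy_transform mu (1 / sqrt_up z) in
  lambda%:C * g ^+ 2 + (1 - lambda)%:C * sqrt_up z * g.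

(* [R[i]^o] is R[i] as a normed space over itself, so that [derivable] is
   complex differentiability.  Only the germ of [K] along the sectors matters,
   and these conditions determine it. *)
Definition is_Hrect_inverse mu (K : R[i] -> R[i]) : Prop :=
  forall alpha : R, 0 < alpha < pi ->
    ((fun z : R[i]^o => (K z / z : R[i]^o))
       @ within (cone alpha) (nbhs (0 : R[i]^o)) --> (1 : R[i]^o)) /\
    exists2 beta : R, 0 < beta &
      forall z : R[i], sector alpha beta z ->
        [/\ derivable (K : R[i]^o -> R[i]^o) z 1,
            Hrect mu (K z) = z & K (Hrect mu z) = z].

Definition Urect (z : R[i]) : R[i] :=
  if lambda == 0 then z
  else (- lambda%:C - 1 + sqrtc ((lambda%:C + 1) ^+ 2 + 4 * lambda%:C * z))
       / (2 * lambda%:C).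

(* [c] represents the germ of the rectangular R-transform of [mu]. *)
Definition is_rect_R_transform mu (c : R[i] -> R[i]) : Prop :=
  exists2 K, is_Hrect_inverse mu K &
    germ_eq c (fun z => Urect (z / K z - 1)).

Definition is_rect_conv mu nu rho : Prop :=
  [/\ symmetric_measure mu, symmetric_measure nu, symmetric_measure rho &
   exists c1 c2, [/\ is_rect_R_transform mu c1, is_rect_R_transform nu c2 &
     is_rect_R_transform rho (fun z => c1 z + c2 z)]].

Inductive is_rect_power nu : nat -> realLaw R -> Prop :=
| rect_power1 : is_rect_power nu 1 nu
| rect_powerS n mu rho : is_rect_power nu n mu -> is_rect_conv mu nu rho ->
    is_rect_power nu n.+1 rho.

Definition rect_infdiv mu : Prop :=
  symmetric_measure mu /\
  forall n : nat, (1 <= n)%N ->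
    exists2 nu : realLaw R, symmetric_measure nu & is_rect_power nu n mu.

Definition is_rect_levy_measure mu (G : finiteMeasureR R) : Prop :=
  [/\ rect_infdiv mu, symmetric_measure G &
   is_rect_R_transform mu (fun z =>
     z * Cintegral G (fun s => (1 + s ^+ 2)%:C / (1 - z * (s ^+ 2)%:C)))].

(* Graph of the rectangular Bercovici-Pata bijection. *)
Definition rect_bercovici_pata mu nu : Prop :=
  exists2 G : finiteMeasureR R, is_levy_measure mu G & is_rect_levy_measure nu G.

End RectangularTransform.

Section Densities.
Variable R : realType.

Definition cauchy_pdf (t x : R) : R := 1 / pi * (t / (x ^+ 2 + t ^+ 2)).

Definition rect_cauchy_pdf (lambda t x : R) : R :=
  \1_(~` `[- (t * (1 - lambda) / 2), t * (1 - lambda) / 2]) x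
  * (t / (pi * (lambda * t ^+ 2 + x ^+ 2)))
  * Num.sqrt (1 - (t ^+ 2 * (lambda - 1) ^+ 2) / (4 * x ^+ 2)).

End Densities.

(* Main.v *)
(* Put a = t (1 - lambda) / 2, b = t (1 + lambda) / 2, and let w denote the
   principal square root of - z.

   The Levy measure of the Cauchy law is (t / pi) ds / (1 + s^2); classically this
   amounts to the values of the integrals of (1 - cos (s x)) / s^2 and
   (1 - cos (s x)) / (s^2 + t^2), both obtained from Tonelli's theorem with
   nonnegative integrands.  On the rectangular side the same Levy measure gives
   the R-transform - t w.

   For the explicit law nu, the substitution s^2 = y^2 + a^2 makes the integrand
   rational and yields
     \int dnu(s) / (p^2 + s^2) = 1 / ((E + a) (E + b)),  E = sqrt (p^2 + a^2),
   for complex p with Re p > 0 (and E <> b).  Hence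
   H_nu(z) = - (b + sqrt (a^2 - 1/z))^-2, whose inverse is
   z / ((1 - lambda t w) (1 - t w)), and the R-transform of nu is - t w.  Since
   this is linear in t, the n-fold rectangular power of the law with parameter
   t / n is the law with parameter t, so nu is infinitely divisible. *)
From HB Require Import structures.
Require Import Defs.
From mathcomp Require Import all_boot all_order all_algebra.
From mathcomp Require Import complex ring lra.
From mathcomp Require Import all_classical all_reals all_analysis measurable_realfun.

Set Implicit Arguments.
Unset Strict Implicit.
Unset Printing Implicit Defensive.

Import Order.TTheory GRing.Theory Num.Theory.
Import numFieldNormedType.Exports.

Local Open Scope classical_set_scope.
Local Open Scope ring_scope.

(** * Measures with a density *)

(** The complex integrals are computed without residues: real and imaginary parts have explicit
    primitives made of rational functions, [atan] and [ln], and the fundamental theorem on a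
    half-line does the rest. Partial fractions degenerate for a = 0 (lambda = 1) and for a = b
    (lambda = 0), and these real cases are treated apart; the complex coincidence E = b is avoided
    by staying close to 0.

    The inversion is explicit because lambda t = b - a and t = b + a. With q = 1 / w, setting q = E
    + b gives E^2 - a^2 = (q - lambda t)(q - t), which is where the two factors of the inverse come
    from. For the explicit law, every choice of a principal root and every nonzero denominator
    follows from Re w > 0 and Re q > 2b, and a small sector ensures both.

    The Levy measure is t times the Cauchy law with parameter 1, which is itself the explicit law
    for a = 0 and b = 1. Its R-transform therefore comes from the same resolvent formula and asks
    for no new integral. *)

Section Densities.
Variable R : realType.
Notation mu := (@lebesgue_measure R).
Implicit Types (f : R -> R) (nu : {measure set (measurableTypeR R) -> \bar R}).
Local Open Scope ereal_scope.

Import HBNNSimple.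

Let density_integral_nnsfun nu f (g : {nnsfun measurableTypeR R >-> R}) :
  has_density nu f -> measurable_fun setT f -> (forall x, (0 <= f x)%R) ->
  \int[nu]_x (g x)%:E = \int[mu]_x ((g x)%:E * (f x)%:E).
Proof.
move=> nuf mf f0.
under [LHS]eq_integral do rewrite fimfunE -fsumEFin//.
rewrite [LHS]ge0_integral_fsum//; last 2 first.
  - by move=> r; exact/measurable_EFinP/measurableT_comp.
  - by move=> n x _; rewrite EFinM nnfun_muleindic_ge0.
under [RHS]eq_integral.
  move=> x xD; rewrite fimfunE -fsumEFin// ge0_mule_fsuml; last first.
    by move=> r; rewrite EFinM nnfun_muleindic_ge0.
  over.
rewrite [RHS]ge0_integral_fsum//; last 2 first.
  - move=> r; apply: emeasurable_funM; apply/measurable_EFinP => //.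
    exact: measurableT_comp.
  - move=> n x _; rewrite mule_ge0//; last by rewrite lee_fin.
    by rewrite EFinM nnfun_muleindic_ge0.
apply: eq_fsbigr => r _.
rewrite integralZl_indic_nnsfun//= integral_indic// setIT nuf//.
under [RHS]eq_integral do rewrite EFinM -muleA.
have [r0|r0] := ltP r 0%R.
  have -> : g @^-1` [set r] = set0 by exact: preimage_nnfun0.
  rewrite integral_set0 mule0; apply/esym/integral0_eq => x _.
  by rewrite indic0 mul0e mule0.
rewrite [RHS]ge0_integralZl//=; last 2 first.
  - by apply: emeasurable_funM; apply/measurable_EFinP.
  - by move=> x _; rewrite mule_ge0// lee_fin.
congr (_ * _); rewrite [LHS]integral_mkcond; apply: eq_integral => x _.
by rewrite epatch_indic muleC.
Qed.

Lemma ge0_integral_density nu f (g : R -> \bar R) :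
  has_density nu f -> measurable_fun setT f -> (forall x, (0 <= f x)%R) ->
  measurable_fun setT g -> (forall x, 0 <= g x) ->
  \int[nu]_x g x = \int[mu]_x (g x * (f x)%:E).
Proof.
move=> nuf mf f0 mg g0.
pose g_ := nnsfun_approx (@measurableT _ (measurableTypeR R)) mg.
transitivity (limn (fun n => \int[nu]_x (g_ n x)%:E)).
  rewrite -monotone_convergence//=.
  - apply: eq_integral => ? _; apply/esym/cvg_lim => //=.
    exact: cvg_nnsfun_approx.
  - by move=> n; exact/measurable_EFinP/measurable_funTS.
  - by move=> n ? _; rewrite lee_fin.
  - by move=> ? _ ? ? mn; rewrite lee_fin; exact/lefP/nd_nnsfun_approx.
under eq_fun do rewrite (density_integral_nnsfun _ nuf)//.
rewrite -monotone_convergence//=.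
- apply: eq_integral => x _; apply/cvg_lim => //=.
  by apply: cvgeZr => //; exact: cvg_nnsfun_approx.
- by move=> n; apply: emeasurable_funM; exact/measurable_EFinP.
- by move=> n ? _; rewrite mule_ge0// lee_fin.
- move=> x _ ? ? mn; rewrite lee_wpmul2r ?lee_fin//.
  exact/lefP/nd_nnsfun_approx.
Qed.

(** Since [f] is nonnegative, the positive and negative parts of the product are those of [g] times
    [f]; the identity then holds part by part, without integrability of [g]. *)
Lemma integral_density nu f (g : R -> \bar R) :
  has_density nu f -> measurable_fun setT f -> (forall x, (0 <= f x)%R) ->
  measurable_fun setT g ->
  \int[nu]_x g x = \int[mu]_x (g x * (f x)%:E).
Proof.
move=> nuf mf f0 mg; rewrite integralE [RHS]integralE.
rewrite !(ge0_integral_density nuf)//; last 2 first.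
  exact: measurable_funeneg.
  exact: measurable_funepos.
by congr (_ - _); apply: eq_integral => x _;
  rewrite ?funeposE ?funenegE -?mulNe maxe_pMl ?lee_fin ?mul0e ?f0.
Qed.

Lemma density_symmetric nu f : has_density nu f -> measurable_fun setT f ->
  (forall x, (0 <= f x)%R) -> (forall x, f (- x)%R = f x) ->
  symmetric_measure nu.
Proof.
move=> nuf mf f0 fN A mA.
have mN : measurable ((fun x : R => - x)%R @^-1` A).
  by rewrite -[X in measurable X]setTI; exact: oppr_measurable.
rewrite !nuf// [RHS](@eq_measure_integral _ _ _ _
  (pushforward mu (-%R : measurableTypeR R -> measurableTypeR R))); last first.
  by move=> B mB _; exact/esym/lebesgue_measureN.
rewrite ge0_integral_pushforward//.
- by apply: eq_integral => x _ /=; rewrite fN.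
- exact/measurable_funTS/measurable_EFinP.
- by move=> x _; rewrite lee_fin.
Qed.

End Densities.

Section DensityMeasure.
Variable R : realType.
Notation mu := (@lebesgue_measure R).
Variables (f : R -> R) (f0 : forall x, 0 <= f x).
Variable (fi : mu.-integrable setT (EFin \o f)).
Local Open Scope ereal_scope.

(** The two proofs are arguments of the term so that the measure instances below, which rest on
    them, can be inferred from it. *)
Definition density_measure of (forall x, 0 <= f x)%R &
    mu.-integrable setT (EFin \o f) : set (measurableTypeR R) -> \bar R :=
  fun A => \int[mu]_(x in A) (f x)%:E.
Local Notation dm := (density_measure f0 fi).

Let dm0 : dm set0 = 0.
Proof. by rewrite /density_measure integral_set0. Qed.

Let dm_ge0 A : 0 <= dm A.
Proof. by rewrite /density_measure integral_ge0//= => x _; rewrite lee_fin. Qed.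

Let dm_sigma_additive : semi_sigma_additive dm.
Proof.
move=> /= A mA tA mUA.
rewrite /density_measure/= integral_bigcup//=; last first.
  exact: (integrableS _ _ (subsetT _)).
apply: is_cvg_ereal_nneg_natsum_cond => n _ _.
by apply: integral_ge0 => /= x ?; rewrite lee_fin.
Qed.

HB.instance Definition _ := isMeasure.Build _ _ _
  dm dm0 dm_ge0 dm_sigma_additive.

Let dm_fin : fin_num_fun dm.
Proof.
move=> A mA; rewrite integrable_fin_num//.
exact: (integrableS _ _ (subsetT _)).
Qed.

HB.instance Definition _ := Measure_isFinite.Build _ _ _ dm dm_fin.

Lemma exists_density_measure : exists nu : finiteMeasureR R, has_density nu f.
Proof. by exists dm. Qed.

End DensityMeasure.

Section DensityProbability.
Variable R : realType.
Notation mu := (@lebesgue_measure R).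
Variables (f : R -> R) (f0 : forall x, 0 <= f x).
Variable (fi : mu.-integrable setT (EFin \o f)).
Hypothesis f1 : (\int[mu]_x (f x)%:E = 1)%E.

Lemma exists_density_probability : exists nu : realLaw R, has_density nu f.
Proof.
pose P := HB.pack_for (realLaw R) (density_measure f0 fi)
  (Measure_isProbability.Build _ _ _ (density_measure f0 fi) f1).
by exists P.
Qed.

End DensityProbability.

(** * Integrals over half-lines *)

Section RealIntegrals.
Variable R : realType.
Notation mu := (@lebesgue_measure R).
Implicit Types (f g F : R -> R).

Lemma ge0_integral_even (f : R -> \bar R) : measurable_fun setT f ->
  (forall x, 0 <= f x)%E -> (forall x, f (- x) = f x) ->
  (\int[mu]_x f x = 2%:E * \int[mu]_(x in `[0%R, +oo[) f x)%E.
Proof.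
move=> mf f0 fN.
have -> : [set: R] = `]-oo, 0[ `|` `[0, +oo[.
  by rewrite -itv_bndbnd_setU// set_itvE.
rewrite ge0_integral_setU//=; last 2 first.
- exact: (measurable_funS measurableT).
- rewrite disj_set2E; apply/eqP/seteqP; split => // x /=.
  by rewrite !in_itv/= andbT => -[x0]; rewrite leNgt x0.
rewrite integral_itv_bndo_bndc; last exact: measurable_funTS.
have -> : (\int[mu]_(x in `]-oo, 0%R]) f x = \int[mu]_(x in `[0%R, +oo[) f x)%E.
  rewrite ge0_integration_by_substitution0//.
  by apply: eq_integral => x _; rewrite fN.
by rewrite -[2%R]/(1 + 1)%R EFinD ge0_muleDl// mul1e.
Qed.

Lemma Rintegral_even f : mu.-integrable setT (EFin \o f) ->
  (forall x, f (- x) = f x) ->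
  \int[mu]_x f x = 2 * \int[mu]_(x in `[0, +oo[) f x.
Proof.
move=> fi fN.
have fi' : mu.-integrable `[0, +oo[ (EFin \o f) by exact: (integrableS _ _ (subsetT _)).
have mf := measurable_int _ fi.
rewrite /Rintegral -[2]/(fine 2%:E) -fineM//; last exact: integrable_fin_num.
congr fine; rewrite integralE [in RHS]integralE.
rewrite !ge0_integral_even//; last 4 first.
- exact: measurable_funeneg.
- by move=> x; rewrite !funenegE /= fN.
- exact: measurable_funepos.
- by move=> x; rewrite !funeposE /= fN.
rewrite [RHS]muleBr//; apply: fin_num_adde_defl; rewrite fin_numN.
exact: integrable_neg_fin_num.
Qed.

(** For integrands without a sign: the truncations to [[a, a + n]] are dominated by [|f|], so the
    integral is the limit of [F (a + n) - F a]. At [a] itself only a right limit of [F] is asked,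
    since the primitives used later are singular there. *)
Lemma integrable_continuous_FTC2y f F a (l : R) :
  mu.-integrable `[a, +oo[ (EFin \o f) ->
  {within `[a, +oo[, continuous f} ->
  F x @[x --> +oo%R] --> l ->
  F x @[x --> a^'+] --> F a ->
  (forall x, a < x -> is_derive x 1 F (f x)) ->
  \int[mu]_(x in `[a, +oo[) f x = l - F a.
Proof.
move=> fi cf Fl Fa dF.
have derF x : a < x -> derivable F x 1 by move=> /dF[].
pose f_ n := EFin \o (f \_ `[a, a + n%:R]).
have mf : measurable_fun `[a, +oo[ f 
  by apply/measurable_EFinP; exact: (measurable_int _ fi).
have intf n : (0 < n)%N ->
    (\int[mu]_(x in `[a, +oo[) (f_ n x) = (F (a + n%:R) - F a)%:E)%E.
  move=> n0.
  have an : a < a + n%:R by rewrite ltrDl ltr0n.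
  rewrite /f_ -restrict_EFin -integral_mkcondr.
  have -> : `[a, +oo[ `&` `[a, a + n%:R] = `[a, a + n%:R]%classic.
    by apply: setIidr; apply: subset_itvl.
  rewrite (@continuous_FTC2 _ f F)//.
  - by apply: continuous_subspaceW cf; apply: subset_itvl.
  - split => //.
    + by move=> x; rewrite in_itv/= => /andP[ax _]; exact: derF.
    + apply/cvg_at_left_filter/differentiable_continuous/derivable1_diffP.
      exact: derF.
  - move=> x; rewrite in_itv/= => /andP[ax _].
    by rewrite derive1E; apply: derive_val; exact: dF.
have h : (\int[mu]_(x in `[a, +oo[) f_ n x)%E @[n --> \oo] -->
    (\int[mu]_(x in `[a, +oo[) (f x)%:E)%E.
  have [] // := @dominated_convergence _ (measurableTypeR R) _ mu `[a, +oo[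
    (measurable_itv _) f_ (EFin \o f) (abse \o (EFin \o f)).
  - move=> n; apply: measurableT_comp => //.
    apply/(measurable_restrict _ (measurable_itv _)) => //.
    by apply: measurable_funS mf => // x [].
  - exact/measurable_EFinP.
  - apply: aeW => x /= ax; apply: cvg_near_cst.
    near=> n; rewrite /f_/= patchE mem_set//= in_itv/=.
    move: ax; rewrite in_itv/= andbT => -> /=.
    by rewrite -lerBlDl; near: n; exact: nbhs_infty_ger.
  - exact: integrable_abse.
  - apply: aeW => x n ax /=; rewrite /f_/= patchE.
    by case: ifPn => // _; rewrite normr0 lee_fin.
rewrite /Rintegral -(cvg_lim _ h)//.
suff -> : limn (fun n => \int[mu]_(x in `[a, +oo[) f_ n x)%E = (l - F a)%:E by [].
apply/cvg_lim => //.
apply: (@cvg_trans _ ((F (a + n%:R) - F a)%:E @[n --> \oo])).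
  by apply: near_eq_cvg; near=> n; rewrite intf//; near: n; exact: nbhs_infty_gt.
apply: cvg_EFin; first exact: nearW.
apply: cvgB; last exact: cvg_cst.
apply/((cvg_pinftyP F l).1 Fl)/cvgryPge => r.
by near do rewrite -lerBlDl; exact: nbhs_infty_ger.
Unshelve. all: by end_near. Qed.

End RealIntegrals.

(** * Improper integrals through explicit primitives *)

Section Primitives.
Variable R : realType.
Implicit Types (g h : R -> R) (c : R[i]).
Local Open Scope complex_scope.

(* The derivative is not prescribed at 0, where an integrand such as
   [y^2 / ((y^2 + a^2) (y^2 + b^2))] takes a junk value when [a = 0]. *)
Definition half_line_primitive g (l : R) := exists A : R -> R,
  [/\ A 0 = 0, {for 0, continuous A}, A y @[y --> +oo%R] --> l &
      forall y : R, 0 < y -> is_derive y 1 A (g y)].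

Lemma half_line_primitive_derive (A g : R -> R) (l : R) : A 0 = 0 ->
  A y @[y --> +oo%R] --> l ->
  (forall y : R, 0 <= y -> is_derive y 1 A (g y)) -> half_line_primitive g l.
Proof.
move=> A0 Al dA; exists A; split => //; last by move=> y /ltW; exact: dA.
by apply/differentiable_continuous/derivable1_diffP; have [] := dA 0 (lexx 0).
Qed.

(** Also serves for scalar multiples, with second coefficient 0 and the same primitive twice. *)
Lemma half_line_primitive_linear g h (x y l m : R) :
  half_line_primitive g l -> half_line_primitive h m ->
  half_line_primitive (fun u => x * g u + y * h u) (x * l + y * m).
Proof.
move=> [A [A0 cA Al dA]] [B [B0 cB Bm dB]].
exists (fun u => x * A u + y * B u); split.
- by rewrite A0 B0 !mulr0 addr0.
- apply: (@cvgD _ R^o).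
    exact: (cvgM (cvg_cst _) cA).
  exact: (cvgM (cvg_cst _) cB).
- apply: (@cvgD _ R^o).
    exact: (cvgM (cvg_cst _) Al).
  exact: (cvgM (cvg_cst _) Bm).
- move=> u u0; have ? := dA u u0; have ? := dB u u0.
  by apply: is_derive_eq; rewrite /GRing.scale/=; ring.
Qed.

Lemma eq_half_line_primitive g h l : (forall y : R, 0 < y -> g y = h y) ->
  half_line_primitive g l -> half_line_primitive h l.
Proof.
by move=> gh [A [A0 cA Al dA]]; exists A; split => // y y0; rewrite -gh//; exact: dA.
Qed.

Definition half_line_cprimitive (g : R -> R[i]) (l : R[i]) :=
  half_line_primitive (fun y => complex.Re (g y)) (complex.Re l) /\
  half_line_primitive (fun y => complex.Im (g y)) (complex.Im l).

Lemma half_line_cprimitive_linear (g h : R -> R[i]) (x y l m : R[i]) :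
  half_line_cprimitive g l -> half_line_cprimitive h m ->
  half_line_cprimitive (fun u => x * g u + y * h u) (x * l + y * m).
Proof.
case: x l y m => [x1 x2] [l1 l2] [y1 y2] [m1 m2] [g1 g2] [h1 h2]; split => /=.
- have := half_line_primitive_linear 1 1
    (half_line_primitive_linear x1 (- x2) g1 g2)
    (half_line_primitive_linear y1 (- y2) h1 h2).
  rewrite !mul1r !mulNr; apply: eq_half_line_primitive => u _.
  by rewrite !mul1r !mulNr; case: (g u) => ? ?; case: (h u) => ? ?.
- have := half_line_primitive_linear 1 1
    (half_line_primitive_linear x2 x1 g1 g2)
    (half_line_primitive_linear y2 y1 h1 h2).
  rewrite !mul1r (addrC (x2 * _)) (addrC (y2 * _)).
  apply: eq_half_line_primitive => u _.
  rewrite !mul1r (addrC (x2 * _)) (addrC (y2 * _)).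
  by case: (g u) => ? ?; case: (h u) => ? ?.
Qed.

Lemma half_line_primitive0 : half_line_primitive (fun=> 0) 0.
Proof.
exists (fun=> 0); split => //; [exact: cvg_cst|exact: cvg_cst|].
by move=> y _; exact: is_derive_cst.
Qed.

Lemma half_line_cprimitive_real g l : half_line_primitive g l ->
  half_line_cprimitive (fun y => (g y)%:C) l%:C.
Proof. by move=> gl; split => //=; exact: half_line_primitive0. Qed.

Lemma eq_half_line_cprimitive (g h : R -> R[i]) l :
  (forall y : R, 0 < y -> g y = h y) ->
  half_line_cprimitive g l -> half_line_cprimitive h l.
Proof.
by move=> gh [g1 g2]; split; [move: g1|move: g2];
  apply: eq_half_line_primitive => y y0; rewrite gh.
Qed.

Lemma cvg_shift_div_pinfty (x y : R) : 0 < x -> (u + y) / x @[u --> +oo%R] --> +oo.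
Proof.
move=> x0; apply: gt0_cvgMly; first by rewrite invr_gt0.
exact: cvg_addrr.
Qed.

Lemma half_line_primitive_cauchy (b : R) : 0 < b ->
  half_line_primitive (fun y => (b ^+ 2 + y ^+ 2)^-1) (pi / (2 * b)).
Proof.
move=> b0.
apply: (@half_line_primitive_derive (fun y => b^-1 * atan ((y + 0) / b))).
- by rewrite add0r mul0r atan0 mulr0.
- have -> : pi / (2 * b) = b^-1 * (pi / 2) by field; rewrite gt_eqF.
  apply: cvgM; first exact: cvg_cst.
  apply: (cvg_comp _ _ (cvg_shift_div_pinfty 0 b0)); exact: cvgy_atan.
- move=> y y0; apply: is_derive_eq.
  rewrite /GRing.scale/=; field.
  by rewrite !gt_eqF// ltr_pwDl ?exprn_gt0// sqr_ge0.
Qed.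

Lemma cvg_inv_pinfty : y^-1 @[y --> +oo%R] --> (0 : R).
Proof.
have /gtr0_cvgV0[_] : \forall y \near +oo%R, 0 < (id : R -> R) y.
  exact: nbhs_pinfty_gt.
by apply.
Qed.

(** Three cases. For a = 0 the integrand collapses to 1 / (y^2 + b^2). For a = b it is half of 1 /
    (y^2 + a^2) minus half of the derivative of y / (y^2 + a^2). Otherwise it is (b^2 / (y^2 + b^2)
    - a^2 / (y^2 + a^2)) / (b^2 - a^2). *)
Lemma half_line_primitive_rational (a b : R) : 0 <= a -> 0 < b ->
  half_line_primitive
    (fun y => y ^+ 2 / ((y ^+ 2 + a ^+ 2) * (y ^+ 2 + b ^+ 2)))
    (pi / (2 * (a + b))).
Proof.
rewrite le_eqVlt => /predU1P[<- b0|a0 b0].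
  rewrite add0r; apply: eq_half_line_primitive (half_line_primitive_cauchy b0).
  move=> y y0; field.
  by rewrite !gt_eqF// ?ltr_pwDl ?exprn_gt0// ?sqr_ge0// ltr_wpDl// ?sqr_ge0 ?exprn_gt0.
have pos (c y : R) : 0 < c -> 0 < y ^+ 2 + c ^+ 2.
  by move=> c0; rewrite ltr_wpDl ?sqr_ge0// exprn_gt0.
have [<-{b b0}|ab] := eqVneq a b.
  have H : half_line_primitive
      (fun y => (a ^+ 2 - y ^+ 2) / (y ^+ 2 + a ^+ 2) ^+ 2) 0.
    apply: (@half_line_primitive_derive (fun y => y / (y ^+ 2 + a ^+ 2))).
    - by rewrite mul0r.
    - apply: (@squeeze_cvgr _ _ _ _ (fun=> 0) (fun y => y^-1)).
      + near=> y; have y0 : 0 < y by near: y; exact: nbhs_pinfty_gt.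
        apply/andP; split; first by rewrite divr_ge0 ?ltW ?pos.
        rewrite ler_pdivrMr ?pos//.
        by rewrite mulrDr expr2 mulKf ?gt_eqF// lerDl mulr_ge0 ?invr_ge0 ?sqr_ge0 ?ltW.
      + exact: cvg_cst.
      + exact: cvg_inv_pinfty.
    - move=> y y0; have p0 := pos a y a0.
      have p0' : y ^+ 2 + a ^+ 2 != 0 by rewrite gt_eqF.
      apply: is_derive_eq.
      by rewrite /GRing.scale/=; field.
  have := half_line_primitive_linear 2^-1 (- 2^-1) (half_line_primitive_cauchy a0) H.
  rewrite mulr0 addr0.
  have -> : 2^-1 * (pi / (2 * a)) = pi / (2 * (a + a)).
    by field; rewrite !gt_eqF// addr_gt0.
  apply: eq_half_line_primitive => y y0; field.
  by rewrite gt_eqF ?pos.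
have ab2 : b ^+ 2 - a ^+ 2 != 0.
  by rewrite subr_eq0 eqf_sqr negb_or eq_sym ab/= -subr_eq0 opprK gt_eqF ?addr_gt0.
have := half_line_primitive_linear (b ^+ 2 / (b ^+ 2 - a ^+ 2))
  (- a ^+ 2 / (b ^+ 2 - a ^+ 2)) (half_line_primitive_cauchy b0)
  (half_line_primitive_cauchy a0).
have -> : b ^+ 2 / (b ^+ 2 - a ^+ 2) * (pi / (2 * b)) +
    - a ^+ 2 / (b ^+ 2 - a ^+ 2) * (pi / (2 * a)) = pi / (2 * (a + b)).
  by field; rewrite ab2 !gt_eqF// addr_gt0.
apply: eq_half_line_primitive => y y0; field.
by rewrite ab2 !gt_eqF ?pos.
Unshelve. all: by end_near. Qed.

(* [2c / (c^2 + y^2) = 1 / (c + iy) + 1 / (c - iy)], whose real and imaginary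
   parts have primitives in terms of [atan] and [ln]. *)
Lemma half_line_cprimitive_cauchy c : 0 < complex.Re c ->
  half_line_cprimitive (fun y => (c ^+ 2 + (y ^+ 2)%:C)^-1) ((pi / 2)%:C / c).
Proof.
case: c => al be /= al0.
set c := al +i* be.
have c0 : c != 0 by rewrite eq_complex /= gt_eqF.
pose q (x : R) := al ^+ 2 + x ^+ 2.
have q0 x : 0 < q x by rewrite ltr_pwDl ?exprn_gt0// sqr_ge0.
have q0' x : al ^+ 2 + x ^+ 2 != 0 by rewrite gt_eqF// q0.
have H : half_line_cprimitive
    (fun y => (al +i* (be + y))^-1 + (al +i* (be - y))^-1) pi%:C.
  split => /=.
  - apply: (@half_line_primitive_derive
      (fun y => atan ((y + be) / al) + atan ((y + - be) / al))).
    + by rewrite !add0r mulNr atanN subrr.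
    + have -> : pi = pi / 2 + pi / 2 :> R by lra.
      apply: (@cvgD _ R^o).
        apply: (cvg_comp _ _ (cvg_shift_div_pinfty be al0)); exact: cvgy_atan.
      apply: (cvg_comp _ _ (cvg_shift_div_pinfty (- be) al0)); exact: cvgy_atan.
    + move=> y y0; apply: is_derive_eq.
      rewrite /GRing.scale/=; field.
      have := q0' (be + y); have := q0' (be - y) => h1 h2.
      by rewrite h1 h2 gt_eqF.
  - apply: (@half_line_primitive_derive
      (fun y => 2^-1 * (ln (q (y - be)) - ln (q (y + be))))).
    + by rewrite !add0r /q sqrrN subrr mulr0.
    (* Each logarithm diverges. Multiplied by y^-2, its argument is the polynomial [p] in y^-1, with
       [p 0 = 1]; the correction cancels in the difference of the two logarithms. *)
    + have lnq x : ln (q (y + x) * (y^-1) ^+ 2) @[y --> +oo%R] --> (0 : R).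
        pose p u := 1 + 2 * x * u + (al ^+ 2 + x ^+ 2) * u ^+ 2 : R.
        apply: (@cvg_trans _ (ln (p y^-1) @[y --> +oo%R])).
          apply: near_eq_cvg; near=> y; congr ln.
          have y0 : y != 0 by rewrite gt_eqF//; near: y; exact: nbhs_pinfty_gt.
          by rewrite /p /q; field.
        have p0 : p 0 = 1 by rewrite /p; ring.
        have lp0 : ln (p 0) = 0 := etrans (congr1 (@ln R) p0) (@ln1 R).
        have cp : {for 0, continuous p}.
          by apply/differentiable_continuous/derivable1_diffP; exact: ex_derive.
        have cl : {for p 0, continuous (@ln R)}.
          exact: (eq_ind_r (fun z => {for z, continuous (@ln R)}) (continuous_ln ltr01) p0).
        have h : ln (p u) @[u --> (0 : R)] --> ln (p 0) := continuous_comp cp cl.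
        exact: (eq_ind _ (fun z => ln (p y^-1) @[y --> +oo%R] --> (z : R))
          (cvg_comp _ _ cvg_inv_pinfty h) _ lp0).
      have -> : 0 = 2^-1 * (0 - 0) :> R by rewrite subrr mulr0.
      apply: (@cvg_trans _ (2^-1 * (ln (q (y + - be) * (y^-1) ^+ 2) -
          ln (q (y + be) * (y^-1) ^+ 2)) @[y --> +oo%R])).
        apply: near_eq_cvg; near=> y.
        have y0 : 0 < y by near: y; exact: nbhs_pinfty_gt.
        rewrite !lnM ?posrE ?exprn_gt0 ?invr_gt0 ?q0//.
        by congr (_ * _); ring.
      by apply: cvgM; [exact: cvg_cst|exact: (cvgB (lnq (- be)) (lnq be))].
    + move=> y y0.
      have ? := q0 (y - be); have ? := q0 (y + be).
      have ? := is_derive1_ln (q0 (y - be)); have ? := is_derive1_ln (q0 (y + be)).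
      rewrite /q; apply: is_derive_eq.
      have := q0' (y + be); have := q0' (y - be); rewrite /GRing.scale/= /q.
      by move=> h1 h2; field; rewrite !q0'.
have h := half_line_cprimitive_linear (2 * c)^-1 0 H H.
rewrite mul0r addr0 in h.
have -> : (pi / 2)%:C / c = (2 * c)^-1 * pi%:C.
  by rewrite rmorphM/= fmorphV rmorph_nat invfM; ring.
apply: eq_half_line_cprimitive h => y y0.
rewrite mul0r addr0.
set yc := y%:C; have y2 : (y ^+ 2)%:C = yc ^+ 2 by rewrite rmorphXn.
have e1 : al +i* (be + y) = c + 'i * yc.
  by apply/eqP; rewrite eq_complex/=; apply/andP; split; apply/eqP; ring.
have e2 : al +i* (be - y) = c - 'i * yc.
  by apply/eqP; rewrite eq_complex/=; apply/andP; split; apply/eqP; ring.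
have n1 : c + 'i * yc != 0 by rewrite -e1 eq_complex/= gt_eqF.
have n2 : c - 'i * yc != 0 by rewrite -e2 eq_complex/= gt_eqF.
have e3 : c ^+ 2 + yc ^+ 2 = (c + 'i * yc) * (c - 'i * yc).
  by rewrite [RHS]mulrC -subr_sqr exprMn sqr_i mulN1r opprK.
rewrite y2 e1 e2 e3; field.
by rewrite c0 n1 n2.
Unshelve. all: by end_near. Qed.

End Primitives.

(** * The law with a spectral gap *)

Section GapDensity.
Variable R : realType.
Notation mu := (@lebesgue_measure R).

Lemma measurable_inv : measurable_fun [set: R] (fun x : R => x^-1).
Proof.
have -> : [set: R] = [set 0] `|` [set~ 0] by rewrite setUv.
apply/measurable_funU => //.
  by apply: measurableC; exact: measurable_set1.
split; first exact: measurable_fun_set1.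
apply: open_continuous_measurable_fun => //.
  apply: closed_openC; exact: closed_eq.
by move=> x; rewrite inE/= => /eqP x0; exact: inv_continuous.
Qed.

Variables a b : R.
Hypotheses (a0 : 0 <= a) (b0 : 0 < b) (ab : a <= b).

(* The density of the statement is the case [a = t (1 - lambda) / 2],
   [b = t (1 + lambda) / 2]: then [a + b = t] and
   [b ^+ 2 - a ^+ 2 = lambda * t ^+ 2]. *)
Definition gap_pdf s : R := \1_(~` `[- a, a]) s *
  ((a + b) / (pi * (b ^+ 2 - a ^+ 2 + s ^+ 2))) * Num.sqrt (1 - a ^+ 2 / s ^+ 2).

(* Unlike [gap_pdf], continuous on [[a, +oo[] even when [a = 0]. *)
Let core s : R := (a + b) / (pi * (b ^+ 2 - a ^+ 2 + s ^+ 2)) *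
  Num.sqrt (1 - a ^+ 2 / s ^+ 2).

Let ab2 : 0 <= b ^+ 2 - a ^+ 2.
Proof. by rewrite subr_ge0 ler_sqr ?nnegrE// ltW. Qed.

Let apb : 0 < a + b. Proof. exact: ltr_wpDl. Qed.

Let core_ge0 s : 0 <= core s.
Proof.
rewrite mulr_ge0 ?sqrtr_ge0// divr_ge0 ?(ltW apb)// mulr_ge0 ?pi_ge0//.
by rewrite addr_ge0 ?sqr_ge0.
Qed.

Lemma gap_pdf_ge0 s : 0 <= gap_pdf s.
Proof. by rewrite /gap_pdf -mulrA mulr_ge0//; exact: core_ge0. Qed.

Lemma gap_pdfN s : gap_pdf (- s) = gap_pdf s.
Proof.
rewrite /gap_pdf sqrrN !indicE.
suff -> : (- s \in ~` `[- a, a]) = (s \in ~` `[- a, a]) by [].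
rewrite !in_setC; congr (~~ _); rewrite !mem_setE !in_itv/=.
by rewrite lerN2 andbC lerNl.
Qed.

Let measurable_core : measurable_fun setT core.
Proof.
apply: measurable_funM; first apply: measurable_funM => //.
  apply: measurableT_comp; first exact: measurable_inv.
  by apply: measurable_funM => //; apply: measurable_funD => //; exact: measurable_funX.
apply: measurableT_comp.
  by apply: continuous_measurable_fun; exact: sqrt_continuous.
apply: measurable_funB => //; apply: measurable_funM => //.
apply: measurableT_comp; first exact: measurable_inv.
exact: measurable_funX.
Qed.

Lemma measurable_gap_pdf : measurable_fun setT gap_pdf.
Proof.
rewrite [X in measurable_fun _ X](_ : _ = (\1_(~` `[- a, a]) : R -> R) \* core).
  apply: measurable_funM; last exact: measurable_core.
  by apply: measurable_indic; exact: measurableC.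
by apply/funext => s; rewrite /gap_pdf -mulrA.
Qed.

Let gap_pdf_in s : s <= a -> - a <= s -> gap_pdf s = 0.
Proof.
move=> sa as_; rewrite /gap_pdf indicE memNset ?mul0r//= in_itv/=.
by rewrite as_ sa.
Qed.

Let gap_pdf_out s : a < s -> gap_pdf s = core s.
Proof.
move=> sa; rewrite /gap_pdf indicE mem_set ?mul1r//= in_itv/= => /andP[_].
by rewrite leNgt sa.
Qed.

Let core_continuous s : a <= s -> {for s, continuous core}.
Proof.
move=> sa.
have h : b ^+ 2 - a ^+ 2 + s ^+ 2 != 0.
  rewrite gt_eqF// -addrA ltr_wpDr ?exprn_gt0// addrC subr_ge0 ler_sqr ?nnegrE//.
  exact: le_trans sa.
apply: (@continuousM).
  apply: (@continuousM); first exact: cst_continuous.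
  apply: (@continuousV).
    by rewrite mulf_neq0// gt_eqF// pi_gt0.
  apply: (@continuousM); first exact: cst_continuous.
  apply: (@continuousD _ R^o); first exact: cst_continuous.
  exact: exprn_continuous.
apply: continuous_comp; last exact: sqrt_continuous.
apply: (@continuousB _ R^o); first exact: cst_continuous.
(* For a = 0 the quotient a^2 / s^2 is constantly 0, so continuity also holds at s = 0. *)
move: a0; rewrite le_eqVlt => /predU1P[<-|a0'].
  rewrite expr0n/= (_ : (fun _ => _) = cst 0); first exact: cst_continuous.
  by apply/funext => x; rewrite mul0r.
apply: (@continuousM); first exact: cst_continuous.
apply: (@continuousV); first by rewrite expf_neq0// gt_eqF// (lt_le_trans a0').
exact: exprn_continuous.
Qed.

Let Y (s : R) : R := Num.sqrt (s ^+ 2 - a ^+ 2).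

(* Substitution [s ^+ 2 = y ^+ 2 + a ^+ 2]. *)
Let core_derive (g A : R -> R) :
  (forall y : R, 0 < y -> is_derive y 1 A
    (y ^+ 2 / ((y ^+ 2 + a ^+ 2) * (y ^+ 2 + b ^+ 2)) * g (Num.sqrt (y ^+ 2 + a ^+ 2)))) ->
  forall s : R, a < s ->
   is_derive s 1 (fun s => (a + b) / pi * A (Y s)) (core s * g s).
Proof.
move=> dA s sa.
have s0 : 0 < s by exact: le_lt_trans sa.
have sa0 : 0 < s ^+ 2 - a ^+ 2 by rewrite subr_gt0 ltr_sqr ?nnegrE// ltW.
have Y0 : 0 < Y s by rewrite sqrtr_gt0.
have Y2 : Y s ^+ 2 = s ^+ 2 - a ^+ 2 by rewrite sqr_sqrtr// ltW.
have dY : is_derive s 1 Y (s / Y s).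
  have sq := is_derive1_sqrt sa0.
  have h : is_derive s 1 (fun s => s ^+ 2 - a ^+ 2) (2 * s).
    by apply: is_derive_eq; rewrite /GRing.scale/=; ring.
  have k := @is_derive1_comp _ (@Num.sqrt R) (fun s : R => s ^+ 2 - a ^+ 2) s _ _ sq h.
  apply: (is_derive_eq k).
  by rewrite /Y; field; rewrite gt_eqF.
have dY' := dA _ Y0.
have h := @is_derive1_comp _ A Y s _ _ dY' dY.
rewrite [X in is_derive _ _ X _](_ : _ = ((a + b) / pi) *: (A \o Y)); last by [].
apply: is_derive_eq.
rewrite /GRing.scale/= /core.
(* The chain rule multiplies Y^2 / (s^2 (Y^2 + b^2)) by s / Y; what is left of the first fraction is
   Y / s, the square root in [core]. *)
have -> : Num.sqrt (1 - a ^+ 2 / s ^+ 2) = Y s / s.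
  transitivity (Y s / Num.sqrt (s ^+ 2)).
    rewrite -sqrtrV ?sqr_ge0// /Y -sqrtrM ?ltW//; congr Num.sqrt.
    by field; rewrite gt_eqF.
  by rewrite sqrtr_sqr ger0_norm ?ltW.
have -> : Y s ^+ 2 + a ^+ 2 = s ^+ 2 by rewrite Y2 subrK.
have -> : Y s ^+ 2 + b ^+ 2 = b ^+ 2 - a ^+ 2 + s ^+ 2 by rewrite Y2; ring.
rewrite sqrtr_sqr ger0_norm ?ltW//; have := @pi_gt0 R.
move: (@pi R) => q q0; field.
by rewrite !gt_eqF//= ltr_wpDl ?exprn_gt0.
Qed.

Let Ya : Y a = 0. Proof. by rewrite /Y subrr sqrtr0. Qed.

Let cvgy_Y : Y s @[s --> +oo%R] --> +oo%R.
Proof.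
apply/cvgryPge => M; near=> s.
have sM : M + a <= s by near: s; apply: nbhs_pinfty_ge; rewrite num_real.
have sa : a <= s by near: s; apply: nbhs_pinfty_ge; rewrite num_real.
have sa0 : 0 <= s - a by rewrite subr_ge0.
(* For s >= a, (s^2 - a^2) - (s - a)^2 = 2 a (s - a) >= 0, so [Y s] is at least s - a. *)
apply: (@le_trans _ _ (s - a)); first by rewrite lerBrDr.
rewrite -[leLHS]ger0_norm// -sqrtr_sqr; apply: ler_wsqrtr.
have := mulr_ge0 a0 sa0; nra.
Unshelve. all: by end_near. Qed.

Let continuous_Y : continuous Y.
Proof.
move=> s.
have h : {for s, continuous (fun s : R => s ^+ 2 - a ^+ 2)}.
  apply: (@continuousB _ R^o); last exact: cst_continuous.
  exact: exprn_continuous.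
exact: continuous_comp h (@sqrt_continuous R _).
Qed.

(** [Y] is not differentiable at [a], so the fundamental theorem is applied with a one-sided limit
    there, and [Y a = 0] reduces that limit to continuity of [A] at 0. *)
Let primitive_cvg (A : R -> R) : A 0 = 0 -> {for 0, continuous A} ->
  (a + b) / pi * A (Y s) @[s --> a^'+] --> (a + b) / pi * A (Y a).
Proof.
move=> A0 cA; apply: cvg_at_right_filter; apply: cvgM; first exact: cvg_cst.
have cA' : {for Y a, continuous A} by rewrite Ya.
have h : {for a, continuous (A \o Y)}.
  by apply: continuous_comp; [exact: continuous_Y|exact: cA'].
exact: h.
Qed.

Let primitive_cvgy (A : R -> R) (l : R) : A y @[y --> +oo%R] --> l ->
  (a + b) / pi * A (Y s) @[s --> +oo%R] --> (a + b) / pi * l.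
Proof.
move=> Al; apply: cvgM; first exact: cvg_cst.
exact: cvg_comp cvgy_Y Al.
Qed.

Let integral_half_support (g : R -> R) : measurable_fun setT g ->
  (\int[mu]_(s in `[0%R, +oo[) (gap_pdf s * g s)%:E =
   \int[mu]_(s in `[a, +oo[) (core s * g s)%:E)%E.
Proof.
move=> mg.
have mfg : measurable_fun setT (fun s => (gap_pdf s * g s)%:E).
  by apply/measurable_EFinP/measurable_funM => //; exact: measurable_gap_pdf.
have -> : `[0, +oo[%classic = `[0, a] `|` `]a, +oo[ :> set R.
  by rewrite -itv_bndbnd_setU// bnd_simp.
rewrite integral_setU//=; last 2 first.
- exact: (measurable_funS measurableT).
- rewrite disj_set2E; apply/eqP/seteqP; split => // x /=.
  by rewrite !in_itv/= andbT => -[/andP[_ x0]]; rewrite ltNge x0.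
rewrite [X in (X + _)%E](_ : _ = 0%E) ?add0e; last first.
  apply: integral0_eq => x /=; rewrite in_itv/= => /andP[x0 xa].
  by rewrite gap_pdf_in ?mul0r// (le_trans _ x0)// oppr_le0.
rewrite -integral_itv_obnd_cbnd; last first.
  by apply/measurable_EFinP/measurable_funTS/measurable_funM.
apply: eq_integral => x; rewrite inE/= in_itv/= andbT => ax.
by rewrite gap_pdf_out.
Qed.

(** The substitution with g = 1: by evenness the mass is twice (a + b) / pi times pi / (2 (a + b)).
    It is proved before any law with this density is available. *)
Let integral_gap_pdf : (\int[mu]_s (gap_pdf s)%:E = 1)%E.
Proof.
have [A [A0 cA Al dA]] := half_line_primitive_rational a0 b0.
rewrite ge0_integral_even/=; last 3 first.
- by apply/measurable_EFinP; exact: measurable_gap_pdf.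
- by move=> x; rewrite lee_fin gap_pdf_ge0.
- by move=> x; rewrite gap_pdfN.
have := @integral_half_support (cst 1) (measurable_cst _).
rewrite /cst; under eq_integral do rewrite mulr1; move=> ->.
under eq_integral do rewrite mulr1.
have dF s : a < s -> is_derive s 1 (fun s => (a + b) / pi * A (Y s)) (core s).
  move=> sa; rewrite -[core s]mulr1; apply: (@core_derive (cst 1)) => // y y0.
  by rewrite /cst mulr1; exact: dA.
rewrite (@ge0_continuous_FTC2y _ core (fun s => (a + b) / pi * A (Y s)) a
  ((a + b) / pi * (pi / (2 * (a + b))))).
- rewrite Ya A0 mulr0 -EFinB -EFinM; congr (_%:E).
  have := @pi_gt0 R; move: (@pi R) => q q0.
  by field; rewrite !gt_eqF.
- by move=> x _; exact: core_ge0.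
- apply: continuous_in_subspaceT => x; rewrite inE/= in_itv/= andbT.
  exact: core_continuous.
- exact: primitive_cvgy.
- by move=> x /dF[].
- exact: primitive_cvg.
- move=> x; rewrite in_itv/= andbT => /dF h.
  by rewrite derive1E; exact: derive_val.
Qed.

Lemma integrable_gap_pdf : mu.-integrable setT (EFin \o gap_pdf).
Proof.
apply/integrableP; split; first by apply/measurable_EFinP; exact: measurable_gap_pdf.
under eq_integral do rewrite /= ger0_norm ?gap_pdf_ge0//.
by rewrite integral_gap_pdf ltry.
Qed.

Lemma exists_gap_law : exists nu : realLaw R, has_density nu gap_pdf.
Proof.
exact: exists_density_probability gap_pdf_ge0 integrable_gap_pdf integral_gap_pdf.
Qed.

(** Boundedness of [g] gives integrability, hence access to the fundamental theorem for integrands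
    without a sign. The factor 2 comes from evenness. *)
Lemma integral_gap_law (nu : realLaw R) (g : R -> R) (l : R) :
  has_density nu gap_pdf -> continuous g -> (forall s, g (- s) = g s) ->
  (exists M, forall s, `|g s| <= M) ->
  half_line_primitive (fun y => y ^+ 2 / ((y ^+ 2 + a ^+ 2) * (y ^+ 2 + b ^+ 2))
    * g (Num.sqrt (y ^+ 2 + a ^+ 2))) l ->
  \int[nu]_s g s = 2 * (a + b) / pi * l.
Proof.
move=> nuf cg gN [M gM] [A [A0 cA Al dA]].
have mg := continuous_measurable_fun cg.
rewrite /Rintegral (integral_density nuf)//; last 3 first.
- exact: measurable_gap_pdf.
- exact: gap_pdf_ge0.
- exact/measurable_EFinP.
have gfi : mu.-integrable setT (EFin \o (fun s => gap_pdf s * g s)).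
  apply: (integrableMl measurableT integrable_gap_pdf mg).
  by exists M; split; [exact: num_real|move=> x Mx y _; exact: le_trans (gM y) (ltW Mx)].
transitivity (\int[mu]_s (gap_pdf s * g s)).
  by congr fine; apply: eq_integral => s _; rewrite -EFinM mulrC.
rewrite Rintegral_even//; last by move=> x; rewrite gap_pdfN gN.
have e := integral_half_support mg.
rewrite /Rintegral e -/(Rintegral _ _ _).
have -> : \int[mu]_(s in `[a, +oo[) (core s * g s) =
    (a + b) / pi * l - (a + b) / pi * A (Y a).
  apply: (@integrable_continuous_FTC2y _ _ (fun s => (a + b) / pi * A (Y s))).
  - apply/integrableP; split.
      by apply/measurable_EFinP/measurable_funTS/measurable_funM.
    under eq_integral do rewrite /= normrM ger0_norm ?core_ge0//.
    (* Integrability of [core * g] beyond [a] is read off from that of [gap_pdf * g] on the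
       half-line, by comparing the integrals of absolute values. *)
    rewrite -(@integral_half_support (fun s => `|g s|)); last exact: measurableT_comp.
    have /integrableP[_] : mu.-integrable `[0%R, +oo[ (EFin \o (fun s => gap_pdf s * g s)).
      exact: (integrableS _ _ (subsetT _)).
    by under eq_integral do rewrite /= normrM ger0_norm ?gap_pdf_ge0//.
  - apply: continuous_in_subspaceT => x; rewrite inE/= in_itv/= andbT => ax.
    by apply: continuousM; [exact: core_continuous|exact: cg].
  - exact: primitive_cvgy.
  - exact: primitive_cvg.
  - by move=> x; exact: core_derive.
rewrite Ya A0 mulr0 subr0.
by have := @pi_gt0 R; move: (@pi R) => q q0; field; rewrite gt_eqF.
Qed.

End GapDensity.

(** * Cauchy transform *)

Section ComplexIntegrals.
Variable R : realType.
Implicit Types (g h : R -> R[i]) (c d : R[i]).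
Local Open Scope complex_scope.

Lemma Re_gt0_neq0 (z : R[i]) : 0 < complex.Re z -> z != 0.
Proof. by move=> z0; rewrite eq_complex negb_and gt_eqF. Qed.

Lemma Re_add (z w : R[i]) : complex.Re (z + w) = complex.Re z + complex.Re w.
Proof. by case: z w => [? ?] []. Qed.

(* Continuous and bounded, hence integrable for every finite measure. *)
Definition tame g := [/\ continuous (fun s => complex.Re (g s)),
  continuous (fun s => complex.Im (g s)) &
  exists M : R, forall s, `|complex.Re (g s)| <= M /\ `|complex.Im (g s)| <= M].

Lemma tame_linear c d g h : tame g -> tame h -> tame (fun s => c * g s + d * h s).
Proof.
case: c d => [c1 c2] [d1 d2] [g1 g2 [M gM]] [h1 h2 [N hN]].
have e1 s : complex.Re ((c1 +i* c2) * g s + (d1 +i* d2) * h s) =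
    c1 * complex.Re (g s) - c2 * complex.Im (g s) +
    (d1 * complex.Re (h s) - d2 * complex.Im (h s)).
  by case: (g s) => ? ?; case: (h s) => ? ?.
have e2 s : complex.Im ((c1 +i* c2) * g s + (d1 +i* d2) * h s) =
    c1 * complex.Im (g s) + c2 * complex.Re (g s) +
    (d1 * complex.Im (h s) + d2 * complex.Re (h s)).
  by case: (g s) => ? ?; case: (h s) => ? ?.
have cM (k : R) (f : R -> R) : continuous f -> continuous (fun s => k * f s).
  by move=> cf s; apply: continuousM; [exact: cst_continuous|exact: cf].
split.
- under eq_fun do rewrite e1.
  by move=> s; apply: (@cvgD _ R^o); apply: (@cvgB _ R^o); exact: cM.
- under eq_fun do rewrite e2.
  by move=> s; apply: (@cvgD _ R^o); apply: (@cvgD _ R^o); exact: cM.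
- exists ((`|c1| + `|c2|) * M + (`|d1| + `|d2|) * N) => s.
  have [? ?] := gM s; have [? ?] := hN s.
  have b (k r K : R) : `|r| <= K -> `|k * r| <= `|k| * K.
    by move=> rK; rewrite normrM ler_wpM2l.
  split; [rewrite e1|rewrite e2]; rewrite !mulrDl;
  apply: (le_trans (ler_normD _ _)); apply: lerD;
  [apply: (le_trans (ler_normB _ _))|apply: (le_trans (ler_normB _ _))
  |apply: (le_trans (ler_normD _ _))|apply: (le_trans (ler_normD _ _))];
  by apply: lerD; exact: b.
Qed.

(** Each component of an inverse is bounded by its modulus, here at most 1 / e. *)
Lemma tame_inv (u v : R -> R) (e : R) : continuous u -> continuous v -> 0 < e ->
  (forall s, e ^+ 2 <= u s ^+ 2 + v s ^+ 2) -> tame (fun s => (u s +i* v s)^-1).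
Proof.
move=> cu cv e0 uv.
have uv0 s : u s ^+ 2 + v s ^+ 2 != 0.
  by rewrite gt_eqF// (lt_le_trans _ (uv s))// exprn_gt0.
have cq s : {for s, continuous (fun s => (u s ^+ 2 + v s ^+ 2)^-1)}.
  apply: cvgV; first exact: uv0.
  apply: (@cvgD _ R^o); first exact: (cvgM (cu s) (cu s)).
  exact: (cvgM (cv s) (cv s)).
have bound (x y : R) : e ^+ 2 <= x ^+ 2 + y ^+ 2 -> `|x / (x ^+ 2 + y ^+ 2)| <= e^-1.
  move=> xy; have q0 : 0 < x ^+ 2 + y ^+ 2 by rewrite (lt_le_trans _ xy)// exprn_gt0.
  rewrite -ler_sqr ?nnegrE ?normr_ge0 ?invr_ge0 ?(ltW e0)//.
  rewrite real_normK ?num_real//.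
  rewrite expr_div_n exprVn ler_pdivrMr ?exprn_gt0//.
  rewrite -ler_pdivrMl ?invr_gt0 ?exprn_gt0// invrK expr2.
  by apply: ler_pM; rewrite ?sqr_ge0// lerDl sqr_ge0.
split => /=.
- by move=> s; apply: cvgM; [exact: cu|exact: cq].
- move=> s; apply: (@cvgN _ R^o); apply: cvgM; [exact: cv|exact: cq].
- exists e^-1 => s; split; first exact: bound.
  by rewrite normrN addrC; apply: bound; rewrite addrC.
Qed.

Lemma eq_Cintegral (mu : {measure set (measurableTypeR R) -> \bar R}) g h :
  (forall s, g s = h s) -> Cintegral mu g = Cintegral mu h.
Proof. by move=> gh; congr Cintegral; apply/funext. Qed.

Section FiniteMeasure.
Variable mu : finiteMeasureR R.

Let bounded_integrable (f : R -> R) M : continuous f -> (forall s, `|f s| <= M) ->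
  mu.-integrable setT (EFin \o f).
Proof.
move=> cf fM; apply: measurable_bounded_integrable => //.
- by rewrite -ge0_fin_numE// fin_num_measure.
- exact: continuous_measurable_fun.
- by exists M; split; [exact: num_real|move=> x Mx y _; exact: le_trans (fM y) (ltW Mx)].
Qed.

Lemma Rintegral_symmetric (f : R -> R) : symmetric_measure mu -> continuous f ->
  (exists M, forall s, `|f s| <= M) ->
  \int[mu]_s f (- s) = \int[mu]_s f s.
Proof.
move=> mus cf [M fM]; congr fine.
rewrite [RHS](@eq_measure_integral _ _ _ _
  (pushforward mu (-%R : measurableTypeR R -> measurableTypeR R))); last first.
  by move=> B mB _; exact/esym/mus.
rewrite integral_pushforward//.
- by apply/measurable_EFinP; exact: continuous_measurable_fun.
- apply: (@bounded_integrable (f \o -%R) M) => [s|s]; last exact: fM.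
  by apply: continuous_comp; [exact: oppr_continuous|exact: cf].
Qed.

(** Brings the Cauchy transform under the integral formula for the gap law, which is restricted to
    even integrands. *)
Lemma Cintegral_even_part g : symmetric_measure mu -> tame g ->
  Cintegral mu g = Cintegral mu (fun s => (g s + g (- s)) / 2).
Proof.
move=> mus [g1 g2 [M gM]].
have half (f : R -> R) : continuous f -> (forall s, `|f s| <= M) ->
    \int[mu]_s f s = \int[mu]_s (2^-1 * (f s + f (- s))).
  move=> cf fM.
  have cfN : continuous (fun s => f (- s)).
    by move=> s; apply: continuous_comp; [exact: oppr_continuous|exact: cf].
  have i1 := bounded_integrable cf fM.
  have i2 := bounded_integrable cfN (fun s => fM (- s)).
  rewrite RintegralZl//; last exact: (integrableD measurableT i1 i2).
  rewrite RintegralD// Rintegral_symmetric//; last by exists M.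
  by field.
rewrite /Cintegral; congr (_ +i* _).
- rewrite half// => [|s]; last by have [] := gM s.
  by apply: eq_Rintegral => s _; case: (g s) => ? ?; case: (g (- s)) => ? ? /=; field.
- rewrite half// => [|s]; last by have [] := gM s.
  by apply: eq_Rintegral => s _; case: (g s) => ? ?; case: (g (- s)) => ? ? /=; field.
Qed.

Lemma Cintegral_linear c d g h : tame g -> tame h ->
  Cintegral mu (fun s => c * g s + d * h s) =
  c * Cintegral mu g + d * Cintegral mu h.
Proof.
case: c d => [c1 c2] [d1 d2] [g1 g2 [M gM]] [h1 h2 [N hN]].
have i1 := bounded_integrable g1 (fun s => proj1 (gM s)).
have i2 := bounded_integrable g2 (fun s => proj2 (gM s)).
have i3 := bounded_integrable h1 (fun s => proj1 (hN s)).
have i4 := bounded_integrable h2 (fun s => proj2 (hN s)).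
have lin (x1 x2 x3 x4 : R) (f1 f2 f3 f4 : R -> R) :
    mu.-integrable setT (EFin \o f1) -> mu.-integrable setT (EFin \o f2) ->
    mu.-integrable setT (EFin \o f3) -> mu.-integrable setT (EFin \o f4) ->
    \int[mu]_s (x1 * f1 s + x2 * f2 s + (x3 * f3 s + x4 * f4 s)) =
    x1 * \int[mu]_s f1 s + x2 * \int[mu]_s f2 s +
    (x3 * \int[mu]_s f3 s + x4 * \int[mu]_s f4 s).
  have iZ x (f : R -> R) : mu.-integrable setT (EFin \o f) ->
    mu.-integrable setT (EFin \o (fun s => x * f s)).
    by move=> fi; exact: (integrableZl measurableT x fi).
  have iD (f k : R -> R) : mu.-integrable setT (EFin \o f) ->
    mu.-integrable setT (EFin \o k) ->
    mu.-integrable setT (EFin \o (fun s => f s + k s)).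
    by move=> fi ki; exact: (integrableD measurableT fi ki).
  move=> j1 j2 j3 j4.
  rewrite (RintegralD measurableT (iD _ _ (iZ x1 _ j1) (iZ x2 _ j2))
    (iD _ _ (iZ x3 _ j3) (iZ x4 _ j4))).
  rewrite (RintegralD measurableT (iZ x1 _ j1) (iZ x2 _ j2)).
  rewrite (RintegralD measurableT (iZ x3 _ j3) (iZ x4 _ j4)).
  by rewrite !RintegralZl.
rewrite /Cintegral; apply/eqP; rewrite eq_complex /=; apply/andP; split; apply/eqP.
- rewrite -!mulNr -lin//; apply: eq_Rintegral => s _.
  by case: (g s) => ? ?; case: (h s) => ? ? /=; rewrite !mulNr.
- rewrite -lin//; apply: eq_Rintegral => s _.
  by case: (g s) => ? ?; case: (h s) => ? ? /=.
Qed.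

Lemma tame_cst c : tame (fun=> c).
Proof.
split; [exact: cst_continuous|exact: cst_continuous|].
exists (`|complex.Re c| + `|complex.Im c|) => _.
by rewrite lerDl lerDr !normr_ge0.
Qed.

End FiniteMeasure.

(** p^2 + s^2 = (p + is)(p - is), and each factor has real part Re p, so the modulus is at least (Re
    p)^2. The ring identity in the proof is the expansion of the product of the two squared
    moduli. *)
Lemma tame_resolvent (p : R[i]) : 0 < complex.Re p ->
  tame (fun s : R => (p ^+ 2 + (s ^+ 2)%:C)^-1).
Proof.
move=> p0.
pose x := complex.Re p; pose y := complex.Im p.
have := @tame_inv (fun s => x ^+ 2 - y ^+ 2 + s ^+ 2) (fun=> 2 * x * y) (x ^+ 2).
rewrite [X in _ -> _ -> _ -> _ -> tame X](_ : _ = (fun s : R => (p ^+ 2 + (s ^+ 2)%:C)^-1)).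
  apply => // [s|s||s].
  - by apply: (@cvgD _ R^o); [exact: cvg_cst|exact: exprn_continuous].
  - exact: cvg_cst.
  - by rewrite exprn_gt0.
  - have -> : (x ^+ 2 - y ^+ 2 + s ^+ 2) ^+ 2 + (2 * x * y) ^+ 2 =
        (x ^+ 2) ^+ 2 + (x ^+ 2 * ((y + s) ^+ 2 + (y - s) ^+ 2) +
        (y + s) ^+ 2 * (y - s) ^+ 2) by ring.
    by rewrite lerDl; apply: addr_ge0; rewrite mulr_ge0 ?addr_ge0 ?sqr_ge0.
apply/funext => s; congr (_^-1); rewrite /x /y; case: (p) => u v.
by apply/eqP; rewrite eq_complex/=; apply/andP; split; apply/eqP; ring.
Qed.

(** * Resolvent and Cauchy transform of the gap law *)

Section GapLaw.
Variables (a b : R) (nu : realLaw R).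
Hypotheses (a0 : 0 <= a) (b0 : 0 < b) (ab : a <= b).
Hypothesis nuE : has_density nu (gap_pdf a b).

Lemma gap_law_symmetric : symmetric_measure nu.
Proof.
apply: (density_symmetric nuE).
- exact: measurable_gap_pdf.
- exact: gap_pdf_ge0.
- exact: gap_pdfN.
Qed.

Lemma Cintegral_gap_law g l : tame g -> (forall s, g (- s) = g s) ->
  half_line_cprimitive (fun y =>
    (y ^+ 2 / ((y ^+ 2 + a ^+ 2) * (y ^+ 2 + b ^+ 2)))%:C *
    g (Num.sqrt (y ^+ 2 + a ^+ 2))) l ->
  Cintegral nu g = (2 * (a + b) / pi)%:C * l.
Proof.
move=> [g1 g2 [M gM]] gN [l1 l2].
have ReM (x : R) (z : R[i]) : complex.Re (x%:C * z) = x * complex.Re z.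
  by case: z => ? ? /=; rewrite mul0r subr0.
have ImM (x : R) (z : R[i]) : complex.Im (x%:C * z) = x * complex.Im z.
  by case: z => ? ? /=; rewrite mul0r addr0.
have conv (k : R -> R) (m : R) : continuous k -> (forall s, k (- s) = k s) ->
    (forall s, `|k s| <= M) ->
    half_line_primitive (fun y => y ^+ 2 / ((y ^+ 2 + a ^+ 2) * (y ^+ 2 + b ^+ 2)) *
      k (Num.sqrt (y ^+ 2 + a ^+ 2))) m ->
    \int[nu]_s k s = 2 * (a + b) / pi * m.
  by move=> ck kN kM; apply: integral_gap_law => //; exists M.
apply/eqP; rewrite eq_complex ReM ImM /=; apply/andP; split; apply/eqP.
- apply: conv => [//|s|s|]; [by rewrite gN|by have [] := gM s|].
  by apply: eq_half_line_primitive l1 => y _; rewrite ReM.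
- apply: conv => [//|s|s|]; [by rewrite gN|by have [] := gM s|].
  by apply: eq_half_line_primitive l2 => y _; rewrite ImM.
Qed.

(* Partial fractions, with [Y = y^2]:
   [Y / ((Y + a^2) (Y + b^2) (Y + E^2))] is [(E^2 - a^2)^-1] times
   [Y / ((Y + a^2) (Y + b^2))
    + (E^2 - b^2)^-1 (b^2 / (Y + b^2) - E^2 / (Y + E^2))]. *)
Lemma half_line_cprimitive_gap (E : R[i]) : 0 < complex.Re E ->
  E ^+ 2 != (a ^+ 2)%:C -> E ^+ 2 != (b ^+ 2)%:C ->
  half_line_cprimitive (fun y =>
    (y ^+ 2 / ((y ^+ 2 + a ^+ 2) * (y ^+ 2 + b ^+ 2)))%:C *
      (E ^+ 2 + (y ^+ 2)%:C)^-1)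
    (pi%:C / (2 * (a + b)%:C * (E + a%:C) * (E + b%:C))).
Proof.
move=> E0 Ea Eb.
have apb : 0 < a + b by exact: ltr_wpDl.
have h1 := half_line_cprimitive_real (half_line_primitive_rational a0 b0).
have h2 := @half_line_cprimitive_cauchy R b%:C b0.
have h3 := half_line_cprimitive_cauchy E0.
pose D := (E ^+ 2 - b%:C ^+ 2)^-1.
pose C := (E ^+ 2 - a%:C ^+ 2)^-1.
have h4 := half_line_cprimitive_linear (D * b%:C ^+ 2) (- D * E ^+ 2) h2 h3.
have := half_line_cprimitive_linear C C h1 h4.
have dD : E ^+ 2 - b%:C ^+ 2 != 0 by rewrite subr_eq0 -rmorphXn.
have dC : E ^+ 2 - a%:C ^+ 2 != 0 by rewrite subr_eq0 -rmorphXn.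
have rc0 (x : R) : x != 0 -> x%:C != 0 :> R[i] by rewrite fmorph_eq0.
have nz (r : R) : 0 <= r -> E + r%:C != 0.
  by move=> r0; rewrite Re_gt0_neq0// Re_add ltr_wpDr.
set l := (X in half_line_cprimitive _ X -> _).
set l' := (X in _ -> half_line_cprimitive _ X).
(* The combination of the three limits is C (pi / 2) (1 / (a + b) - 1 / (E + b)); the difference
   produces a factor E - a, which cancels against C. *)
have -> : l = l'.
  rewrite /l /l' /C /D.
  have Enz := Re_gt0_neq0 E0.
  have := nz _ a0; have := nz _ (ltW b0) => nb na.
  have bnz : b%:C != 0 :> R[i] by rewrite rc0// gt_eqF.
  have abnz : a%:C + b%:C != 0 :> R[i] by rewrite -rmorphD rc0// gt_eqF.
  move: (@pi R) => q {l l' h1 h2 h3 h4 C D}.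
  rewrite !(rmorphM, rmorphD, fmorphV, rmorph_nat)/=.
  move: dC dD nb na bnz abnz Enz; move: a%:C b%:C q%:C => u v w *.
  by field; do ! [apply/andP; split => //].
apply: eq_half_line_cprimitive => y y0.
have ya : 0 < y ^+ 2 + a ^+ 2 by rewrite ltr_pwDl ?exprn_gt0// sqr_ge0.
have yb : 0 < y ^+ 2 + b ^+ 2 by rewrite ltr_pwDl ?exprn_gt0// sqr_ge0.
have yE : E ^+ 2 + (y ^+ 2)%:C != 0.
  have -> : E ^+ 2 + (y ^+ 2)%:C = (E + 'i%C * y%:C) * (E - 'i%C * y%:C).
    by rewrite [RHS]mulrC -subr_sqr exprMn sqr_i rmorphXn; ring.
  rewrite mulf_neq0// Re_gt0_neq0// Re_add /=; case: (E) E0 => ? ? /=;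
    by rewrite ?(mul0r, mulr0, subrr, oppr0, addr0).
rewrite !(rmorphM, rmorphD, fmorphV, rmorphXn)/=.
have := rc0 _ (lt0r_neq0 ya); have := rc0 _ (lt0r_neq0 yb).
move: dC dD yE; rewrite /C /D !(rmorphD, rmorphXn)/=.
move: a%:C b%:C y%:C => u v w *; field.
by rewrite -!expr2; do ! [apply/andP; split => //].
Qed.

(** Under s^2 = y^2 + a^2 the denominator p^2 + s^2 becomes E^2 + y^2, whence the relation imposed
    on [E]. That E^2 differs from a^2 is automatic, as p is nonzero. *)
Lemma Cintegral_gap_resolvent (p E : R[i]) :
  0 < complex.Re p -> 0 < complex.Re E -> E ^+ 2 = p ^+ 2 + (a ^+ 2)%:C ->
  E ^+ 2 != (b ^+ 2)%:C ->
  Cintegral nu (fun s => (p ^+ 2 + (s ^+ 2)%:C)^-1) =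
  ((E + a%:C) * (E + b%:C))^-1.
Proof.
move=> p0 E0 Ep Eb.
have Ea : E ^+ 2 != (a ^+ 2)%:C.
  by rewrite Ep -subr_eq0 addrK expf_neq0// Re_gt0_neq0.
have apb : 0 < a + b by exact: ltr_wpDl.
have h := half_line_cprimitive_gap E0 Ea Eb.
rewrite (@Cintegral_gap_law _
    (pi%:C / (2 * (a + b)%:C * (E + a%:C) * (E + b%:C))))//; last 3 first.
- exact: tame_resolvent.
- by move=> s; rewrite sqrrN.
- apply: eq_half_line_cprimitive h => y y0.
  rewrite sqr_sqrtr ?addr_ge0 ?sqr_ge0// Ep rmorphD /=.
  by congr (_ * _^-1); ring.
have nz (r : R) : 0 <= r -> E + r%:C != 0.
  by move=> r0; rewrite Re_gt0_neq0// Re_add ltr_wpDr.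
have := nz _ a0; have := nz _ (ltW b0).
have : pi%:C != 0 :> R[i] by rewrite fmorph_eq0 gt_eqF ?pi_gt0.
have : (a + b)%:C != 0 :> R[i] by rewrite fmorph_eq0 gt_eqF.
move: (@pi R) => q {h}.
rewrite !(rmorphM, fmorphV, rmorph_nat)/=.
move: (a + b)%:C q%:C => u v *; field; rewrite ?andbT.
by do ! [apply/andP; split => //].
Qed.

(** The even part of s -> 1 / (-ip - s) is ip / (p^2 + s^2). The point -ip is the one that [Hrect]
    uses: [1 / sqrt_up z] is -i / w, so that p = 1 / w. *)
Lemma cauchy_transform_gap_law (p E : R[i]) :
  0 < complex.Re p -> 0 < complex.Re E -> E ^+ 2 = p ^+ 2 + (a ^+ 2)%:C ->
  E ^+ 2 != (b ^+ 2)%:C ->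
  cauchy_transform nu (- ('i%C * p)) = 'i%C * p / ((E + a%:C) * (E + b%:C)).
Proof.
move=> p0 E0 Ep Eb.
have tame1 : tame (fun s : R => (- ('i%C * p) - s%:C)^-1).
  have := @tame_inv (fun s => complex.Im p - s) (fun=> - complex.Re p) (complex.Re p).
  rewrite [X in _ -> _ -> _ -> _ -> tame X](_ : _ = (fun s : R => (- ('i%C * p) - s%:C)^-1)).
    apply => // [s|s|s]; last by rewrite sqrrN lerDr sqr_ge0.
    - by apply: (@cvgB _ R^o); [exact: cvg_cst|exact: cvg_id].
    - exact: cvg_cst.
  apply/funext => s; congr (_^-1); case: (p) => x y.
  by apply/eqP; rewrite eq_complex/=; apply/andP; split; apply/eqP; ring.
rewrite /cauchy_transform.
rewrite (@Cintegral_even_part nu _ gap_law_symmetric tame1).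
have tame2 := tame_resolvent p0.
rewrite (@eq_Cintegral _ _ (fun s : R => 'i%C * p * (p ^+ 2 + (s ^+ 2)%:C)^-1 +
  0 * (p ^+ 2 + (s ^+ 2)%:C)^-1)); last first.
  move=> s; rewrite mul0r addr0 rmorphN rmorphXn/=.
  have p2 : p ^+ 2 = - ('i%C * p) ^+ 2 by rewrite exprMn sqr_i mulN1r opprK.
  have h (r : R) : - ('i%C * p) - r%:C != 0.
    rewrite eq_complex negb_and; apply/orP; right; case: (p) p0 => x y /= x0.
    by rewrite mul0r mul1r add0r subr0 oppr_eq0 gt_eqF.
  have := h s; have := h (- s); rewrite rmorphN/= p2 opprK.
  move: ('i%C * p) s%:C => P S h1 h2.
  have e : - P ^+ 2 + S ^+ 2 != 0.
    have -> : - P ^+ 2 + S ^+ 2 = - ((- P + S) * (- P - S)) by ring.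
    by rewrite oppr_eq0 mulf_neq0.
  by field; rewrite -?expr2; do ! [apply/andP; split => //].
rewrite (@Cintegral_linear nu)// mul0r addr0.
by rewrite (Cintegral_gap_resolvent p0 E0 Ep Eb).
Qed.

End GapLaw.
End ComplexIntegrals.

(** * The principal square root *)

Section ComplexSquareRoot.
Variable R : realType.
Implicit Types (z w u : R[i]).
Local Open Scope complex_scope.

Lemma CabsE z : Cabs z = Num.sqrt (complex.Re z ^+ 2 + complex.Im z ^+ 2).
Proof. by rewrite /Cabs normc_def. Qed.

Lemma Re_sqrtc z : complex.Re (sqrtc z) = Num.sqrt ((Cabs z + complex.Re z) / 2).
Proof. by rewrite CabsE; case: z. Qed.

Lemma Re_sqrtc_ge0 z : 0 <= complex.Re (sqrtc z).
Proof. by rewrite Re_sqrtc sqrtr_ge0. Qed.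

Lemma Cabs_sqrtc z : Cabs (sqrtc z) ^+ 2 = Cabs z.
Proof.
have h : `|sqrtc z| ^+ 2 = `|z| by rewrite -normrX sqr_sqrtc.
by rewrite /Cabs -h normc_def -rmorphXn.
Qed.

Lemma sqrtc_sqr w : 0 < complex.Re w -> sqrtc (w ^+ 2) = w.
Proof.
move=> w0; have /eqP := sqr_sqrtc (w ^+ 2).
rewrite eqf_sqr => /orP[/eqP//|/eqP e].
have := Re_sqrtc_ge0 (w ^+ 2); rewrite e.
by case: w w0 {e} => x y /= x0; rewrite oppr_ge0 leNgt x0.
Qed.

(** The hypothesis says that [z] avoids the cut, the closed negative half-line. *)
Lemma Re_sqrtc_gt0 z : (complex.Im z = 0 -> 0 < complex.Re z) ->
  0 < complex.Re (sqrtc z).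
Proof.
move=> z0; rewrite Re_sqrtc sqrtr_gt0 divr_gt0// CabsE.
case: z z0 => x y /= z0.
have [y0|y0] := eqVneq y 0.
  by rewrite ltr_wpDl ?sqrtr_ge0//; exact: z0.
have y2 : 0 < y ^+ 2 by rewrite exprn_even_gt0.
rewrite -[X in _ + X]opprK subr_gt0.
apply: (@le_lt_trans _ _ `|x|); first by rewrite -normrN ler_norm.
by rewrite -sqrtr_sqr ltr_sqrt ?ltrDl// ltr_wpDl ?sqr_ge0.
Qed.

Lemma Re_le_Cabs z : complex.Re z <= Cabs z.
Proof.
rewrite CabsE (le_trans (ler_norm _))// -sqrtr_sqr ler_wsqrtr//.
by rewrite lerDl sqr_ge0.
Qed.

Lemma Re_inv z : complex.Re z^-1 = complex.Re z / Cabs z ^+ 2.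
Proof.
rewrite CabsE sqr_sqrtr ?addr_ge0 ?sqr_ge0//; by case: z.
Qed.

Lemma Cabs_gt0 z : (0 < Cabs z) = (z != 0).
Proof. by rewrite /Cabs -normr_gt0 normc_def ltcR. Qed.

Lemma Re_inv_gt0 z : 0 < complex.Re z -> 0 < complex.Re z^-1.
Proof.
by move=> z0; rewrite Re_inv divr_gt0// exprn_gt0// Cabs_gt0 Re_gt0_neq0.
Qed.

(** On the sector -z has argument within alpha of 0, so w = sqrt (-z) satisfies Re w >= d |z|^(1/2),
    where [d] is cos (alpha / 2) written by the half-angle formula. Then Re (1 / w) = Re w / |z| is
    at least d / |z|^(1/2), which exceeds M once |z| < (d / M)^2. *)
Lemma sector_sqrtc (alpha M : R) : 0 < alpha < pi -> 0 < M ->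
  exists2 beta, 0 < beta & forall z, sector alpha beta z ->
    0 < complex.Re (sqrtc (- z)) /\ M < complex.Re (sqrtc (- z))^-1.
Proof.
move=> /andP[al0 alpi] M0.
pose d := Num.sqrt ((1 + cos alpha) / 2).
have d0 : 0 < d.
  rewrite sqrtr_gt0 divr_gt0// -ltrBlDl sub0r -cospi.
  by rewrite ltr_cos// in_itv/= ?pi_ge0 ?(ltW al0) ?(ltW alpi) ?lexx.
exists ((d / M) ^+ 2); first by rewrite exprn_gt0// divr_gt0.
move=> z [argz /andP[z0 zb]].
have absN : Cabs (- z) = Cabs z by rewrite /Cabs normrN.
have key : d * Num.sqrt (Cabs z) <= complex.Re (sqrtc (- z)).
  pose x := complex.Re z.
  have xz : -1 <= x / Cabs z <= 1.
    rewrite ler_pdivlMr// ler_pdivrMr// mulN1r mul1r Re_le_Cabs.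
    by rewrite lerNl -absN (le_trans _ (Re_le_Cabs _))// /x; case: (z).
  (* The quotient is the cosine of the argument, which lies within alpha of pi; both branches of
     [Carg] give [acos] a value above pi - alpha. *)
  have : x / Cabs z <= - cos alpha.
    have th : pi - alpha < acos (x / Cabs z).
      move: argz; rewrite /Carg -/x ltr_norml; case: ifP => _ /andP[? ?]; lra.
    have -> : - cos alpha = cos (pi - alpha).
      by rewrite cosB cospi sinpi mul0r addr0 mulN1r.
    rewrite -(acosK xz) ltW// ltr_cos// in_itv/=.
      by rewrite subr_ge0 (ltW alpi) gerBl ltW.
    by rewrite acos_ge0// acos_lepi.
  rewrite ler_pdivrMr// mulNr => h.
  rewrite Re_sqrtc absN /d -sqrtrM; last first.
    by rewrite divr_ge0// -lerBlDl sub0r cos_geN1.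
  rewrite ler_wsqrtr//.
  have -> : complex.Re (- z) = - x by rewrite /x; case: (z).
  rewrite mulrAC ler_pM2r ?invr_gt0// mulrDl mul1r lerD2l lerNr//.
have w0 : 0 < complex.Re (sqrtc (- z)).
  by rewrite (lt_le_trans _ key)// mulr_gt0// sqrtr_gt0.
split => //; rewrite Re_inv Cabs_sqrtc absN.
rewrite ltr_pdivlMr//; apply: lt_le_trans key.
rewrite -{1}(sqr_sqrtr (ltW z0)) expr2 mulrA ltr_pM2r ?sqrtr_gt0//.
rewrite mulrC -ltr_pdivlMr// -[ltRHS]ger0_norm; last by rewrite divr_ge0 ?ltW.
by rewrite -sqrtr_sqr ltr_sqrt// exprn_gt0// divr_gt0.
Qed.

(** z - u factors through the sum of the two roots, whose real part is at least that of [sqrtc u]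
    because principal roots have nonnegative real part. The bound thus holds for [z] on either side
    of the cut. *)
Lemma sqrtc_lipschitz u z : 0 < complex.Re (sqrtc u) ->
  `|sqrtc z - sqrtc u| <= `|z - u| / (complex.Re (sqrtc u))%:C.
Proof.
move=> u0.
have e : z - u = (sqrtc z - sqrtc u) * (sqrtc z + sqrtc u).
  by rewrite -subr_sqr !sqr_sqrtc.
rewrite ler_pdivlMr ?ltcR// e normrM ler_wpM2l//.
apply: le_trans (normc_ge_Re _); rewrite lecR Re_add.
by rewrite ger0_norm ?addr_ge0 ?Re_sqrtc_ge0// lerDr Re_sqrtc_ge0.
Qed.

Definition csqrt : R[i]^o -> R[i]^o := @sqrtc R.

Lemma csqrt_continuous (u : R[i]^o) : 0 < complex.Re (sqrtc u) ->
  {for u, continuous csqrt}.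
Proof.
move=> u0.
apply/(@cvgrPdist_le R[i] R[i]^o _ (nbhs u) (nbhs_filter u) csqrt) => e e0.
set r := complex.Re (sqrtc u) in u0.
near=> z.
rewrite distrC; apply: (le_trans (sqrtc_lipschitz z u0)).
rewrite ler_pdivrMr ?ltcR// distrC.
near: z; apply: (@cvgr_dist_le R[i] R[i]^o _ (nbhs u)); first exact: cvg_id.
by rewrite mulr_gt0// ltcR.
Unshelve. all: by end_near. Qed.

(** Although 0 lies on the cut, the squared modulus of [sqrtc z] is |z|. *)
Lemma csqrt_continuous0 : {for (0 : R[i]^o), continuous csqrt}.
Proof.
apply/(@cvgrPdist_le R[i] R[i]^o _ (nbhs (0 : R[i]^o)) (nbhs_filter _) csqrt) => e e0.
near=> z.
rewrite /csqrt sqrtc0 sub0r normrN -(@ler_sqr _ `|_|) ?nnegrE ?(ltW e0)//.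
rewrite -normrX sqr_sqrtc -normrN -sub0r.
near: z; apply: (@cvgr_dist_le R[i] R[i]^o _ (nbhs (0 : R[i]^o))); first exact: cvg_id.
by rewrite exprn_gt0.
Unshelve. all: by end_near. Qed.

(** The difference quotient is the inverse of the sum of the roots at h + u and at u, so continuity
    of the root suffices. *)
Lemma csqrt_derivable (u : R[i]^o) : 0 < complex.Re (sqrtc u) ->
  derivable csqrt u 1.
Proof.
move=> u0; apply/cvg_ex; exists ((2 * sqrtc u)^-1 : R[i]^o).
apply: (@cvg_trans _ ((sqrtc (h + u) + sqrtc u)^-1 @[h --> (0 : R[i]^o)^'])).
  apply: near_eq_cvg; near=> h.
  have h0 : h != 0 by near: h; exact: nbhs_dnbhs_neq.
  have s0 : sqrtc (h + u) + sqrtc u != 0.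
    by rewrite Re_gt0_neq0// Re_add ltr_wpDl// Re_sqrtc_ge0.
  rewrite /GRing.scale/= mulr1 /csqrt.
  have e : h = (sqrtc (h + u) - sqrtc u) * (sqrtc (h + u) + sqrtc u).
    by rewrite -subr_sqr !sqr_sqrtc addrK.
  have D0 : sqrtc (h + u) - sqrtc u != 0.
    by apply: contra_neq h0 => D0; rewrite e D0 mul0r.
  rewrite [in RHS]/= {2}e.
  by field; rewrite D0 s0.
have cu : (h + u) @[h --> (0 : R[i]^o)^'] --> (u : R[i]^o).
  rewrite -[X in _ --> X]add0r; apply: cvgD; last exact: cvg_cst.
  exact: cvg_within.
have cs : csqrt (h + u) @[h --> (0 : R[i]^o)^'] --> csqrt u.
  exact: (cvg_comp _ _ cu (csqrt_continuous u0)).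
have s0 : csqrt u != 0 by rewrite Re_gt0_neq0.
have -> : (2 * sqrtc u)^-1 = (csqrt u + csqrt u)^-1 by congr (_^-1); rewrite /csqrt; ring.
apply: (@cvgV R[i]).
  by rewrite -mulr2n mulrn_eq0.
apply: cvgD; first exact: cs.
exact: cvg_cst.
Unshelve. all: by end_near. Qed.

End ComplexSquareRoot.

(** * Rectangular R-transform *)

(** Gives the normalization K(z) / z --> 1, with c = lambda t, d = t and w the root of -z. *)
Lemma cvg_inv_factors (K : numFieldType) (S : Type) (F : set_system S)
  {FF : Filter F} (c d : K) (w : S -> K^o) : w x @[x --> F] --> (0 : K^o) ->
  (((1 - c * w x) * (1 - d * w x))^-1 : K^o) @[x --> F] --> (1 : K^o).
Proof.
move=> w0.
have lin (k : K) : (1 - k * w x : K^o) @[x --> F] --> (1 : K^o).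
  rewrite -[X in _ --> X]subr0 -(mulr0 k).
  by apply: cvgB; [exact: cvg_cst|apply: cvgM; [exact: cvg_cst|exact: w0]].
rewrite -[X in _ --> X]invr1; apply: (@cvgV K); first exact: oner_neq0.
by rewrite -[X in _ --> X](mulr1 1); apply: cvgM; exact: lin.
Qed.

Section RectangularCauchy.
Variable R : realType.
Variables lambda t : R.
Hypotheses (l01 : 0 <= lambda <= 1) (t0 : 0 < t).
Local Open Scope complex_scope.
Let a : R := t * (1 - lambda) / 2.
Let b : R := t * (1 + lambda) / 2.
Let L : R[i] := lambda%:C.
Let T : R[i] := t%:C.

Let a0 : 0 <= a.
Proof.
by move: l01 => /andP[_ l1]; rewrite /a divr_ge0// mulr_ge0 ?subr_ge0// ltW.
Qed.

Let b0 : 0 < b.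
Proof.
by move: l01 => /andP[l0 _]; rewrite /b divr_gt0// mulr_gt0// ltr_pwDl.
Qed.

Let ab : a <= b. Proof. 
move: l01 => /andP[l0 _]; have := mulr_ge0 (ltW t0) l0; rewrite /a /b; lra.
 Qed.
Let aE : a%:C = T * (1 - L) / 2.
Proof. by rewrite /a /T /L !(rmorphM, rmorphB, fmorphV, rmorph_nat, rmorph1). Qed.
Let bE : b%:C = T * (1 + L) / 2.
Proof. by rewrite /b /T /L !(rmorphM, rmorphD, fmorphV, rmorph_nat, rmorph1). Qed.

Lemma rect_cauchy_pdfE : rect_cauchy_pdf lambda t = gap_pdf a b.
Proof.
apply/funext => s; rewrite /rect_cauchy_pdf /gap_pdf.
have -> : a + b = t by rewrite /a /b; field.
have -> : b ^+ 2 - a ^+ 2 = lambda * t ^+ 2 by rewrite /a /b; field.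
congr (_ * Num.sqrt (1 - _)).
(* At s = 0 both quotients are 0, by the convention that 0 has inverse 0. *)
have [->|s0] := eqVneq s 0; first by rewrite expr0n/= mulr0 invr0 !mulr0.
by rewrite /a; field.
Qed.

Section Transform.
Variable nu : realLaw R.
Hypothesis nuE : has_density nu (rect_cauchy_pdf lambda t).

Let nuE' : has_density nu (gap_pdf a b).
Proof. by rewrite -rect_cauchy_pdfE. Qed.

(** Over the common denominator (E + a)(E + b)^2 the numerator is -(lambda (E - a) + (1 - lambda)(E
    + b)). Since (1 - lambda) b - lambda a = a, it equals -(E + a), which cancels one factor. *)
Lemma Hrect_rect_cauchy (z E : R[i]) (v := sqrtc (- z)) :
  0 < complex.Re v -> 0 < complex.Re E ->
  E ^+ 2 = v^-1 ^+ 2 + (a ^+ 2)%:C -> E ^+ 2 != (b ^+ 2)%:C ->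
  Hrect lambda nu z = - ((E + b%:C)^-1 ^+ 2).
Proof.
move=> v0 E0 Ev Eb; have vnz := Re_gt0_neq0 v0.
have i2 : 'i%C * 'i%C = -1 :> R[i] by rewrite -expr2 sqr_i.
have inz : 'i%C != 0 :> R[i] by rewrite eq_complex/= oner_eq0 andbF.
rewrite /Hrect /sqrt_up -/v.
have iV : 'i%C^-1 = - 'i%C :> R[i].
  by apply: (mulfI inz); rewrite mulfV// mulrN i2 opprK.
have -> : 1 / ('i%C * v) = - ('i%C * v^-1) by rewrite div1r invfM iV mulNr.
have p0 := Re_inv_gt0 v0.
have pnz := Re_gt0_neq0 p0.
rewrite (cauchy_transform_gap_law a0 b0 ab nuE' p0 E0 Ev Eb).
have nz (r : R) : 0 <= r -> E + r%:C != 0.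
  by move=> r0; rewrite Re_gt0_neq0// Re_add ltr_wpDr.
have := nz _ a0; have := nz _ (ltW b0).
have {Ev}p2 : v^-1 ^+ 2 = (E - a%:C) * (E + a%:C).
  by rewrite -subr_sqr Ev rmorphXn addrK.
move=> nb na.
set g := 'i%C * v^-1 / _.
have -> : g ^+ 2 = - ((E - a%:C) / ((E + a%:C) * (E + b%:C) ^+ 2)).
  rewrite /g 2!exprMn sqr_i p2 exprVn; field.
  by rewrite na nb.
have -> : (1 - lambda)%:C * ('i%C * v) * g =
    - ((1 - L) / ((E + a%:C) * (E + b%:C))).
  rewrite /g rmorphB rmorph1 -/L.
  transitivity ((1 - L) * ('i%C * 'i%C) / ((E + a%:C) * (E + b%:C))).
    by field; rewrite vnz na nb.
  by rewrite i2 mulrN1 mulNr.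
move: na nb; rewrite -/L aE bE; move: (T) (L) => T' L' na nb; field.
have dbl c : E + c / 2 != 0 -> E * 2 + c != 0.
  move=> c0; have -> : E * 2 + c = (E + c / 2) * 2 by field.
  by rewrite mulf_neq0.
by rewrite !dbl.
Qed.

End Transform.

(** The sum is the imaginary part of (x + iy)^2 as it comes out of computation. *)
Let sqr_real_part (x y : R) : 0 < x -> x * y + y * x = 0 -> y = 0.
Proof.
move=> x0 /eqP; rewrite (mulrC y) -mulr2n mulrn_eq0 mulf_eq0 (gt_eqF x0)/=.
by move/eqP.
Qed.

(** If E^2 + r is real then so is E, and its value (Re E)^2 + r is positive: the cut is avoided. *)
Lemma Re_sqrtc_sqr_shift (E : R[i]) (r : R) : 0 < complex.Re E ->
  - r < complex.Re E ^+ 2 -> 0 < complex.Re (sqrtc (E ^+ 2 + r%:C)).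
Proof.
move=> E0 Er; apply: Re_sqrtc_gt0; case: E E0 Er => x y /= x0 xr.
rewrite addr0 => /(sqr_real_part x0) ->; rewrite mulr0 subr0.
by rewrite -ltrBlDr sub0r.
Qed.

Lemma sqr_neq_real (E : R[i]) (r : R) : 0 < complex.Re E ->
  r < complex.Re E ^+ 2 -> E ^+ 2 != r%:C.
Proof.
case: E => x y /= x0 xr; apply/eqP => -[e1 /(sqr_real_part x0) y0].
by move: xr; rewrite -e1 y0 mulr0 subr0 expr2 ltxx.
Qed.

Definition rect_K (z : R[i]^o) : R[i]^o :=
  z * ((1 - L * T * csqrt (- z)) * (1 - T * csqrt (- z)))^-1.

(** The roots lambda t and t are b - a and b + a. This links the factored form of [rect_K] to the
    variable E = q - b, in which [Hrect] is explicit. *)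
Let factorE (q : R[i]) : (q - L * T) * (q - T) = (q - b%:C) ^+ 2 - (a ^+ 2)%:C.
Proof. by rewrite rmorphXn/= aE bE; move: T L => T' L'; field. Qed.

Lemma rect_KE (z : R[i]) (w := sqrtc (- z)) : 0 < complex.Re w ->
  rect_K z = - ((w^-1 - b%:C) ^+ 2 - (a ^+ 2)%:C)^-1.
Proof.
move=> w0; have wnz := Re_gt0_neq0 w0.
rewrite /rect_K -factorE /csqrt -/w.
have zE : z = - w ^+ 2 by rewrite sqr_sqrtc opprK.
have -> : 1 - L * T * w = w * (w^-1 - L * T) by rewrite mulrBr mulfV// (mulrC w).
have -> : 1 - T * w = w * (w^-1 - T) by rewrite mulrBr mulfV// (mulrC w).
rewrite mulrACA -expr2 [in LHS]zE invfM mulNr mulVKf//.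
by rewrite expf_neq0.
Qed.

(** * Inverting the transform H of the explicit law *)

Section Inverse.
Variable nu : realLaw R.
Hypothesis nuE : has_density nu (rect_cauchy_pdf lambda t).

Let b2 : 2 * b = t + lambda * t. Proof. by rewrite /b; field. Qed.

(** The bound 2b makes E = 1 / w - b satisfy Re E > b >= a. Hence E^2 - a^2 is off the cut, its
    principal root [p] is the inverse of the root of - [rect_K z], and E^2 differs from b^2, so the
    formula for [Hrect] applies with this [E]. *)
Lemma Hrect_rect_K (z : R[i]) (w := sqrtc (- z)) : 0 < complex.Re w ->
  2 * b < complex.Re w^-1 -> Hrect lambda nu (rect_K z) = z.
Proof.
move=> w0 q0.
have zE : z = - w ^+ 2 by rewrite sqr_sqrtc opprK.
pose E := w^-1 - b%:C.
have ReE : complex.Re E = complex.Re w^-1 - b.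
  by rewrite /E; case: (w^-1) => ? ?.
have bE' : b < complex.Re E by rewrite ReE ltrBrDr; move: q0; lra.
have E0 : 0 < complex.Re E := lt_trans b0 bE'.
have aE' : a < complex.Re E := le_lt_trans ab bE'.
pose p := sqrtc (E ^+ 2 + (- a ^+ 2)%:C).
have p0 : 0 < complex.Re p.
  by apply: Re_sqrtc_sqr_shift => //; rewrite opprK ltr_sqr ?nnegrE// ltW.
have p2 : p ^+ 2 = E ^+ 2 - (a ^+ 2)%:C by rewrite sqr_sqrtc rmorphN.
have vE : sqrtc (- rect_K z) = p^-1.
  rewrite rect_KE// opprK -/E -p2 -exprVn sqrtc_sqr//.
  exact: Re_inv_gt0.
rewrite (@Hrect_rect_cauchy _ nuE _ E) ?vE ?invrK//.
- by rewrite /E subrK invrK.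
- exact: Re_inv_gt0.
- by rewrite p2 subrK.
- by apply: sqr_neq_real => //; rewrite ltr_sqr ?nnegrE// ltW.
Qed.

Lemma rect_K_Hrect (z : R[i]) (w := sqrtc (- z)) : 0 < complex.Re w ->
  2 * b < complex.Re w^-1 -> rect_K (Hrect lambda nu z) = z.
Proof.
move=> w0 q0.
have zE : z = - w ^+ 2 by rewrite sqr_sqrtc opprK.
have Rw := Re_inv_gt0 w0.
pose E := sqrtc (w^-1 ^+ 2 + (a ^+ 2)%:C).
have E0 : 0 < complex.Re E.
  apply: Re_sqrtc_sqr_shift => //.
  by rewrite (@le_lt_trans _ _ 0) ?oppr_le0 ?sqr_ge0// exprn_gt0.
have E2 : E ^+ 2 = w^-1 ^+ 2 + (a ^+ 2)%:C by rewrite sqr_sqrtc.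
have Eb : E ^+ 2 != (b ^+ 2)%:C.
  (* Otherwise w^-2 would be the real number b^2 - a^2 <= b^2 < (Re w^-1)^2. *)
  rewrite E2 eq_sym -subr_eq -rmorphB eq_sym; apply: sqr_neq_real => //.
  rewrite (@le_lt_trans _ _ (b ^+ 2)) ?lerBlDr ?lerDl ?sqr_ge0//.
  by rewrite ltr_sqr ?nnegrE ?ltW//; move: q0 b0; lra.
have HE := Hrect_rect_cauchy nuE w0 E0 E2 Eb.
have Q0 : 0 < complex.Re (E + b%:C) by rewrite Re_add addr_gt0.
have vE : sqrtc (- Hrect lambda nu z) = (E + b%:C)^-1.
  by rewrite HE opprK sqrtc_sqr//; exact: Re_inv_gt0.
rewrite rect_KE ?vE; last exact: Re_inv_gt0.
by rewrite invrK addrK E2 addrK exprVn invrK -zE.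
Qed.

Let Re_sub_gt0 (q : R[i]) (r : R) : r < complex.Re q -> q - r%:C != 0.
Proof.
by case: q => x y /= rx; rewrite Re_gt0_neq0//= subr_gt0.
Qed.

(** The factors vanish only when 1 / w is lambda t or t, and 2b = t + lambda t bounds both. *)
Lemma rect_K_factor_neq0 (w : R[i]) : 0 < complex.Re w ->
  2 * b < complex.Re w^-1 -> (1 - L * T * w) * (1 - T * w) != 0.
Proof.
move=> w0 q0; have wnz := Re_gt0_neq0 w0.
have /andP[l0 l1] := l01.
have lt0 : 0 <= lambda * t by rewrite mulr_ge0// ltW.
have -> : 1 - L * T * w = w * (w^-1 - L * T) by rewrite mulrBr mulfV// (mulrC w).
have -> : 1 - T * w = w * (w^-1 - T) by rewrite mulrBr mulfV// (mulrC w).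
rewrite !mulf_neq0//; last first.
  by apply: Re_sub_gt0; rewrite (le_lt_trans _ q0)// b2 lerDl.
by rewrite /L /T -rmorphM; apply: Re_sub_gt0; rewrite (le_lt_trans _ q0)// b2 lerDr ltW.
Qed.

Lemma rect_K_derivable (z : R[i]^o) : 0 < complex.Re (sqrtc (- z)) ->
  2 * b < complex.Re (sqrtc (- z))^-1 -> derivable rect_K z 1.
Proof.
move=> w0 q0.
have dw : derivable (fun z : R[i]^o => csqrt (- z)) z 1.
  have d1 : differentiable (fun z : R[i]^o => - z : R[i]^o) z.
    by apply/derivable1_diffP; apply: derivableN; exact: derivable_id.
  have d2 : differentiable (@csqrt R) (- z).
    by apply/derivable1_diffP; exact: csqrt_derivable.
  apply/derivable1_diffP. exact: (differentiable_comp d1 d2).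
have dl c : derivable (fun z : R[i]^o => 1 - c * csqrt (- z) : R[i]^o) z 1.
  apply: derivableB; first exact: derivable_cst.
  by apply: derivableM; [exact: derivable_cst|exact: dw].
apply: derivableM; first exact: derivable_id.
apply: derivableV; first exact: rect_K_factor_neq0.
by apply: derivableM; exact: dl.
Qed.

Lemma is_Hrect_inverse_rect_K : is_Hrect_inverse lambda nu rect_K.
Proof.
move=> alpha al; split; last first.
  have b20 : 0 < 2 * b by rewrite mulr_gt0.
  have [beta be0 H] := sector_sqrtc al b20.
  exists beta => // z /H[w0 q0]; split.
  - exact: rect_K_derivable.
  - exact: Hrect_rect_K.
  - exact: rect_K_Hrect.
have FF : Filter (within (cone alpha) (nbhs (0 : R[i]^o))) by exact: within_filter.
have cw : (csqrt (- z) @[z --> (0 : R[i]^o)]) --> (0 : R[i]^o).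
  have cN : (- z @[z --> (0 : R[i]^o)]) --> (0 : R[i]^o).
    have := @cvgN _ R[i]^o _ (nbhs (0 : R[i]^o)) _ id 0 cvg_id.
    by rewrite oppr0; apply; exact: nbhs_filter.
  have c0 : (csqrt z @[z --> (0 : R[i]^o)]) --> (0 : R[i]^o).
    have := @csqrt_continuous0 R.
    by rewrite /continuous_at [X in _ --> X -> _]sqrtc0.
  exact: (cvg_comp _ (@csqrt R) cN c0).
have cw' : csqrt (- z) @[z --> within (cone alpha) (nbhs (0 : R[i]^o))] --> (0 : R[i]^o).
  by apply: cvg_trans cw; apply: cvg_app; exact: cvg_within.
apply: cvg_trans (cvg_inv_factors (L * T) T cw').
apply: near_eq_cvg; apply: filterS (withinT (cone alpha) (nbhs_filter (0 : R[i]^o))) => z [z0 _].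
by rewrite /rect_K [RHS]mulrAC mulfV// mul1r.
Qed.

End Inverse.

(** The radicand in [Urect] is the square of lambda + 1 - 2 lambda t w. The principal root returns
    this number itself because its real part is positive: Re w Re (1 / w) <= 1 yields (1 + lambda) t
    Re w < 1, and 2 lambda <= 1 + lambda. *)
Lemma Urect_rect_K (z : R[i]) (w := sqrtc (- z)) : z != 0 -> 0 < complex.Re w ->
  2 * b < complex.Re w^-1 -> Urect lambda (z / rect_K z - 1) = - T * w.
Proof.
move=> z0 w0 q0.
have -> : z / rect_K z = (1 - L * T * w) * (1 - T * w).
  by rewrite /rect_K invfM invrK mulVKf.
rewrite /Urect; case: eqP => [l0|/eqP l0].
  by rewrite /L l0 mul0r mul0r subr0 mul1r addrC addKr mulNr.
have Lnz : L != 0 by rewrite fmorph_eq0.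
have -> : (L + 1) ^+ 2 + 4 * L * ((1 - L * T * w) * (1 - T * w) - 1) =
    (L + 1 - 2 * L * T * w) ^+ 2 by ring.
rewrite sqrtc_sqr.
  by rewrite -/L; field.
have /andP[l0' l1] := l01.
have -> : complex.Re (L + 1 - 2 * L * T * w) = lambda + 1 - 2 * lambda * t * complex.Re w.
  by rewrite /L /T; case: (w) => x y /=; ring.
have wq : complex.Re w * (2 * b) < 1.
  apply: (@lt_le_trans _ _ (complex.Re w * complex.Re w^-1)).
    by rewrite ltr_pM2l.
  rewrite Re_inv mulrA -expr2 ler_pdivrMr ?mul1r; last first.
    by rewrite exprn_gt0// Cabs_gt0 Re_gt0_neq0.
  by rewrite ler_sqr ?nnegrE ?(ltW w0) ?Re_le_Cabs// (le_trans (ltW w0))// Re_le_Cabs.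
have b2' : 2 * b = t + lambda * t by rewrite /b; field.
have y0 : 0 <= complex.Re w * t by rewrite mulr_ge0 ?ltW.
have y1 : lambda * (complex.Re w * t) <= complex.Re w * t.
  by rewrite ler_piMl.
have -> : 2 * lambda * t * complex.Re w = 2 * (lambda * (complex.Re w * t)) by ring.
have : complex.Re w * t + lambda * (complex.Re w * t) < 1.
  by move: wq; rewrite b2'; congr (_ < _); ring.
lra.
Qed.

(** Stated for any representative [c] of the germ, as it is applied to a sum of two transforms and
    to the integral against the Levy measure. *)
Lemma rect_R_transform_rect_cauchy (nu : realLaw R) (c : R[i] -> R[i]) :
  has_density nu (rect_cauchy_pdf lambda t) ->
  germ_eq c (fun z => - T * sqrtc (- z)) -> is_rect_R_transform lambda nu c.
Proof.
move=> nuE cE; exists rect_K; first exact: is_Hrect_inverse_rect_K.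
move=> alpha al.
have b20 : 0 < 2 * b by rewrite mulr_gt0.
have [beta be0 H] := sector_sqrtc al b20.
have [gamma ga0 G] := cE _ al.
exists (Num.min beta gamma) => [|z [argz]]; first by rewrite lt_min be0 ga0.
rewrite lt_min => /and3P[z0 zb zg].
have [w0 q0] : 0 < complex.Re (sqrtc (- z)) /\ 2 * b < complex.Re (sqrtc (- z))^-1.
  by apply: H; split=> //; rewrite z0.
rewrite G; last by split=> //; rewrite z0.
by rewrite Urect_rect_K// -Cabs_gt0.
Qed.

End RectangularCauchy.

(** * Cosine integrals *)

Section CosineIntegrals.
Variable R : realType.
Notation mu := (@lebesgue_measure R).
Local Notation D := (`[0%R, +oo[%classic : set R).

Lemma one_sub_cos_ge0 (x : R) : 0 <= 1 - cos x.
Proof. by rewrite subr_ge0 cos_le1. Qed.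

Lemma measurable_one_sub_cos d (S : measurableType d) (f : S -> R) :
  measurable_fun setT f -> measurable_fun setT (fun x => 1 - cos (f x)).
Proof.
move=> mf; apply: measurable_funB => //; apply: measurableT_comp => //.
by apply: continuous_measurable_fun; exact: continuous_cos.
Qed.

Lemma half_line_tonelli (f : R -> R -> R) :
  measurable_fun setT (fun z : measurableTypeR R * measurableTypeR R => f z.1 z.2) ->
  (forall x y, 0 <= x -> 0 <= y -> 0 <= f x y) ->
  (\int[mu]_(x in D) \int[mu]_(y in D) (f x y)%:E =
   \int[mu]_(y in D) \int[mu]_(x in D) (f x y)%:E)%E.
Proof.
move=> mf f0.
pose F (z : measurableTypeR R * measurableTypeR R) :=
  (f z.1 z.2 * (\1_D z.1 * \1_D z.2))%:E.
have mD : measurable (D : set (measurableTypeR R)) by [].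
have mF : measurable_fun setT F.
  apply/measurable_EFinP; apply: measurable_funM => //.
  by apply: measurable_funM; apply: measurableT_comp => //; exact: measurable_indic.
have F0 z : (0 <= F z)%E.
  rewrite lee_fin !indicE !mem_setE !in_itv/= !andbT.
  by case: (leP 0 (z.1 : R)) => z1; case: (leP 0 (z.2 : R)) => z2;
    rewrite ?(mul0r, mulr0)// !mulr1 f0.
have := fubini_tonelli (m1 := mu) (m2 := mu) F mF F0.
rewrite [X in X = _ -> _](_ : _ = (\int[mu]_(x in D) \int[mu]_(y in D) (f x y)%:E)%E).
  rewrite [X in _ = X -> _](_ : _ = (\int[mu]_(y in D) \int[mu]_(x in D) (f x y)%:E)%E)//.
  rewrite [RHS]integral_mkcond; apply: eq_integral => y _.
  rewrite patchE; case: ifPn => yD.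
    rewrite [RHS]integral_mkcond; apply: eq_integral => x _.
    by rewrite epatch_indic /F/= (indicE _ D y) yD mulr1.
  apply: integral0_eq => x _.
  by rewrite /F/= (indicE _ D y) (negbTE yD) !mulr0.
rewrite [RHS]integral_mkcond; apply: eq_integral => x _.
rewrite patchE; case: ifPn => xD.
  rewrite [RHS]integral_mkcond; apply: eq_integral => y _.
  by rewrite epatch_indic /F/= (indicE _ D x) xD mul1r.
apply: integral0_eq => y _.
by rewrite /F/= (indicE _ D x) (negbTE xD) mul0r mulr0.
Qed.

Lemma integral_half_line_primitive (g : R -> R) (l : R) :
  (forall x, 0 <= x -> 0 <= g x) -> (forall x, 0 <= x -> {for x, continuous g}) ->
  half_line_primitive g l -> (\int[mu]_(x in D) (g x)%:E = l%:E)%E.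
Proof.
move=> g0 cg [A [A0 cA Al dA]].
rewrite (@ge0_continuous_FTC2y _ g A 0 l)//.
- by rewrite A0 sube0.
- apply: continuous_in_subspaceT => x; rewrite inE/= in_itv/= andbT.
  exact: cg.
- by move=> x /dA[].
- exact: cvg_at_right_filter.
- by move=> x; rewrite in_itv/= andbT => /dA h; rewrite derive1E; exact: derive_val.
Qed.

Lemma cvgy_expRN (s : R) : 0 < s -> expR (- (u * s)) @[u --> +oo%R] --> (0 : R).
Proof.
move=> s0; apply: (cvg_comp (fun u => u * s) (fun x => expR (- x))); last exact: cvgr_expR.
by apply: gt0_cvgMly => //; exact: cvg_id.
Qed.

(** The exponential of us is the square of that of us / 2, hence at least (us / 2)^2; this is the
    origin of the majorant 4 / (s^2 u). *)
Lemma cvgy_mul_expRN (s : R) : 0 < s -> u * expR (- (u * s)) @[u --> +oo%R] --> (0 : R).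
Proof.
move=> s0.
apply: (@squeeze_cvgr _ _ _ _ (fun=> 0) (fun u => 4 / s ^+ 2 * u^-1)).
- near=> u.
  have u0 : 0 < u by near: u; exact: nbhs_pinfty_gt.
  apply/andP; split; first by rewrite mulr_ge0 ?expR_ge0 ?ltW.
  have h : (u * s / 2) ^+ 2 <= expR (u * s).
    have -> : expR (u * s) = expR (u * s / 2) ^+ 2.
      by rewrite expr2 -expRD; congr expR; field.
    have us : 0 <= u * s / 2 by rewrite divr_ge0// mulr_ge0// ltW.
    rewrite ler_sqr ?nnegrE ?expR_ge0//.
    by rewrite (le_trans _ (expR_ge1Dx _))// lerDr.
  rewrite expRN ler_pdivrMr ?expR_gt0//.
  apply: le_trans (ler_wpM2l _ h).
    by rewrite le_eqVlt; apply/orP; left; apply/eqP; field; rewrite !gt_eqF.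
  by rewrite mulr_ge0 ?divr_ge0 ?invr_ge0 ?sqr_ge0 ?ltW.
- exact: cvg_cst.
- rewrite -[X in _ --> X](mulr0 (4 / s ^+ 2)).
  by apply: cvgM; [exact: cvg_cst|exact: cvg_inv_pinfty].
Unshelve. all: by end_near. Qed.

Lemma half_line_primitive_mul_expRN (s : R) : 0 < s ->
  half_line_primitive (fun u => u * expR (- (u * s))) (s ^- 2).
Proof.
move=> s0.
apply: (@half_line_primitive_derive _
  (fun u => s ^- 2 - (s^-1 * (u * expR (- (u * s))) + s ^- 2 * expR (- (u * s))))).
- by rewrite !mul0r oppr0 expR0 mulr0 add0r mulr1 subrr.
- have h : s ^- 2 - (s^-1 * 0 + s ^- 2 * 0) = s ^- 2 by rewrite !mulr0 addr0 subr0.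
  rewrite -[X in _ --> X]h.
  apply: cvgB; first exact: cvg_cst.
  apply: cvgD; (apply: cvgM; first exact: cvg_cst).
    exact: cvgy_mul_expRN.
  exact: cvgy_expRN.
- move=> u u0; apply: is_derive_eq.
  rewrite /GRing.scale/=; move: (expR _) => e; field.
  by rewrite gt_eqF.
Qed.

(** Laplace transform of 1 - cos at rate [u]. It evaluates an inner integral in both applications of
    Tonelli's theorem below. *)
Lemma half_line_primitive_expRN_cos (u y : R) : 0 < u ->
  half_line_primitive (fun s => expR (- (s * u)) * (1 - cos (s * y)))
    (u^-1 - u / (u ^+ 2 + y ^+ 2)).
Proof.
move=> u0; have uy : 0 < u ^+ 2 + y ^+ 2 by rewrite ltr_pwDl ?exprn_gt0 ?sqr_ge0.
apply: (@half_line_primitive_derive _ (fun s => (u^-1 - u / (u ^+ 2 + y ^+ 2)) +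
  expR (- (s * u)) * ((u ^+ 2 + y ^+ 2)^-1 * (u * cos (s * y) - y * sin (s * y)) - u^-1))).
- rewrite !mul0r oppr0 expR0 cos0 sin0; field.
  by rewrite !gt_eqF.
- rewrite -[X in _ --> X]addr0; apply: cvgD; first exact: cvg_cst.
  pose M := (u ^+ 2 + y ^+ 2)^-1 * (u + `|y|) + u^-1.
  have M0 s : `|(u ^+ 2 + y ^+ 2)^-1 * (u * cos (s * y) - y * sin (s * y)) - u^-1| <= M.
    apply: (le_trans (ler_normB _ _)); apply: lerD; last by rewrite gtr0_norm// invr_gt0.
    rewrite normrM gtr0_norm ?invr_gt0// ler_pM2l ?invr_gt0//.
    apply: (le_trans (ler_normB _ _)); rewrite !normrM gtr0_norm//; apply: lerD.
      by apply: ler_piMr; [exact: ltW|exact: cos_max].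
    by apply: ler_piMr => //; exact: sin_max.
  have lim k : k * expR (- (s * u)) @[s --> +oo%R] --> (0 : R).
    rewrite -[X in _ --> X](mulr0 k); apply: cvgM; first exact: cvg_cst.
    exact: cvgy_expRN.
  apply: (@squeeze_cvgr _ _ _ _ (fun s => - M * expR (- (s * u)))
    (fun s => M * expR (- (s * u)))); [|exact: lim|exact: lim].
  apply: nearW => s; rewrite mulNr -ler_norml normrM ger0_norm ?expR_ge0// mulrC.
  by rewrite ler_wpM2r ?expR_ge0.
- move=> s s0; apply: is_derive_eq.
  rewrite /GRing.scale/=; move: (expR _) (cos _) (sin _) => e c d; field.
  by rewrite !gt_eqF.
Qed.

End CosineIntegrals.

#[local] Hint Resolve one_sub_cos_ge0 : core.

Section CauchyCosine.
Variable R : realType.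
Notation mu := (@lebesgue_measure R).
Local Notation D := (`[0%R, +oo[%classic : set R).

Let Dge0 (x : R) : x \in D -> 0 <= x.
Proof. by rewrite inE/= in_itv/= andbT. Qed.

Let measurable_expRN d (S : measurableType d) (f : S -> R) :
  measurable_fun setT f -> measurable_fun setT (fun x => expR (- f x)).
Proof.
move=> mf; apply: measurableT_comp; first exact: measurable_expR.
exact: measurable_funN.
Qed.

(* Tonelli, from [s^-2 = \int_0^oo u e^(-us) du]. *)
Lemma integral_one_sub_cos_div_sqr (y : R) :
  (\int[mu]_(s in D) ((1 - cos (s * y)) / s ^+ 2)%:E = (pi / 2 * `|y|)%:E)%E.
Proof.
have [->|y0] := eqVneq y 0.
  rewrite normr0 mulr0; apply: integral0_eq => s _.
  by rewrite mulr0 cos0 subrr mul0r.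
pose f s u : R := u * expR (- (u * s)) * (1 - cos (s * y)).
have mf : measurable_fun setT
    (fun z : measurableTypeR R * measurableTypeR R => f z.1 z.2).
  apply: measurable_funM; last first.
    by apply: measurable_one_sub_cos; apply: measurable_funM.
  apply: measurable_funM => //; apply: measurable_expRN.
  exact: measurable_funM.
have f0 s u : 0 <= s -> 0 <= u -> 0 <= f s u.
  by move=> s0 u0; rewrite !mulr_ge0 ?expR_ge0.
transitivity (\int[mu]_(s in D) \int[mu]_(u in D) (f s u)%:E)%E.
  apply: eq_integral => s /Dge0; rewrite le_eqVlt => /predU1P[<-|s0].
    rewrite mul0r cos0 subrr mul0r; apply/esym/integral0_eq => u _.
    by rewrite /f mul0r cos0 subrr mulr0.
  apply/esym/integral_half_line_primitive => [u u0|u u0|].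
  - by apply: f0 => //; exact: ltW.
  - apply/differentiable_continuous/derivable1_diffP; exact: ex_derive.
  - have h := half_line_primitive_mul_expRN s0.
    have := half_line_primitive_linear (1 - cos (s * y)) 0 h h.
    rewrite mul0r addr0; apply: eq_half_line_primitive => u _.
    by rewrite mul0r addr0 mulrC.
rewrite half_line_tonelli//.
have inner u : 0 < u ->
    (\int[mu]_(s in D) (f s u)%:E = (y ^+ 2 * (`|y| ^+ 2 + u ^+ 2)^-1)%:E)%E.
  move=> u0; apply: integral_half_line_primitive => [s s0|s s0|].
  - by apply: f0 => //; exact: ltW.
  - apply/differentiable_continuous/derivable1_diffP; exact: ex_derive.
  - have h := half_line_primitive_expRN_cos y u0.
    have := half_line_primitive_linear u 0 h h.
    rewrite mul0r addr0 real_normK ?num_real//.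
    have -> : u * (u^-1 - u / (u ^+ 2 + y ^+ 2)) = y ^+ 2 * (y ^+ 2 + u ^+ 2)^-1.
      field; rewrite (addrC (y ^+ 2)) gt_eqF//=; first by rewrite gt_eqF.
      by rewrite ltr_pwDl ?exprn_gt0 ?sqr_ge0.
    apply: eq_half_line_primitive => s _.
    by rewrite mul0r addr0 /f (mulrC s u) mulrA.
pose h (u : R) : R := y ^+ 2 * (`|y| ^+ 2 + u ^+ 2)^-1.
have ch : continuous h.
  move=> u; have yu : `|y| ^+ 2 + u ^+ 2 != 0.
    by rewrite gt_eqF// ltr_pwDl ?sqr_ge0// exprn_gt0// normr_gt0.
  by apply/differentiable_continuous/derivable1_diffP; exact: ex_derive.
have mh : measurable_fun setT (EFin \o h).
  by apply/measurable_EFinP; exact: continuous_measurable_fun.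
(* At u = 0 the inner integral is 0 whereas [h 0] is 1, so the endpoint is removed for the
   replacement and restored afterwards. *)
rewrite -integral_itv_obnd_cbnd; last first.
  apply: eq_measurable_fun (measurable_funTS mh) => u.
  by rewrite inE/= in_itv/= andbT => u0; rewrite inner.
transitivity (\int[mu]_(u in `]0%R, +oo[) (h u)%:E)%E.
  by apply: eq_integral => u; rewrite inE/= in_itv/= andbT => u0; rewrite inner.
rewrite integral_itv_obnd_cbnd; last exact: measurable_funTS.
apply: integral_half_line_primitive => [u _|u _|].
- by rewrite mulr_ge0 ?sqr_ge0// invr_ge0 addr_ge0 ?sqr_ge0.
- exact: ch.
- have y0' : 0 < `|y| by rewrite normr_gt0.
  have k := half_line_primitive_cauchy y0'.
  have := half_line_primitive_linear (y ^+ 2) 0 k k.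
  rewrite mul0r addr0; have -> : y ^+ 2 * (pi / (2 * `|y|)) = pi / 2 * `|y|.
    by rewrite -[y ^+ 2]real_normK ?num_real//; field; rewrite normr_eq0.
  by apply: eq_half_line_primitive => u _; rewrite mul0r addr0.
Qed.

Let kernel_ge0 (y s : R) : 0 <= (1 - cos (s * y)) / s ^+ 2.
Proof. by rewrite divr_ge0 ?sqr_ge0. Qed.

Let measurable_invX (n : nat) : measurable_fun setT (fun s : R => s ^- n).
Proof. by apply: measurableT_comp; [exact: measurable_inv|exact: measurable_funX]. Qed.

Let measurable_kernel (y : R) : measurable_fun setT (fun s : R => (1 - cos (s * y)) / s ^+ 2).
Proof.
apply: measurable_funM; last exact: measurable_invX.
by apply: measurable_one_sub_cos; exact: measurable_funM.
Qed.

(* [2 (1 - cos A) (1 - cos B) + (1 - cos (A + B)) + (1 - cos (A - B))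
   = 2 (1 - cos A) + 2 (1 - cos B)], with all terms nonnegative. *)
Lemma integral_one_sub_cos_mul (x y : R) : 0 <= x -> 0 <= y ->
  (\int[mu]_(s in D) ((1 - cos (s * y)) * (1 - cos (s * x)) / s ^+ 2)%:E =
   (pi / 2 * Num.min x y)%:E)%E.
Proof.
move=> x0 y0.
pose k z s : R := (1 - cos (s * z)) / s ^+ 2.
pose P s : R := (1 - cos (s * y)) * (1 - cos (s * x)) / s ^+ 2.
have kE z : (\int[mu]_(s in D) (k z s)%:E = (pi / 2 * `|z|)%:E)%E.
  exact: integral_one_sub_cos_div_sqr.
have mk z : measurable_fun D (EFin \o k z).
  by apply/measurable_EFinP; apply: measurable_funTS; exact: measurable_kernel.
have k0 z s : D s -> (0 <= (k z s)%:E)%E by move=> _; rewrite lee_fin kernel_ge0.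
have P0 s : D s -> (0 <= (P s)%:E)%E.
  by move=> _; rewrite lee_fin divr_ge0 ?sqr_ge0// mulr_ge0.
have mP : measurable_fun D (EFin \o P).
  apply/measurable_EFinP; apply: measurable_funTS.
  apply: measurable_funM; last exact: measurable_invX.
  by apply: measurable_funM; apply: measurable_one_sub_cos; exact: measurable_funM.
have kP s : P s + (2^-1 * k (x + y) s + 2^-1 * k (x - y) s) = k x s + k y s.
  rewrite /P /k (mulrDr s x) (mulrBr s x) cosD cosB; move: (s ^- 2) => c.
  by field.
have e1 : (\int[mu]_(s in D) ((k x s)%:E + (k y s)%:E) = (pi / 2 * x + pi / 2 * y)%:E)%E.
  transitivity (\int[mu]_(s in D) (k x s)%:E + \int[mu]_(s in D) (k y s)%:E)%E.
    by apply: ge0_integralD => //; [exact: k0|exact: (mk x)|exact: k0|exact: (mk y)].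
  by rewrite !kE !ger0_norm.
have half z : (\int[mu]_(s in D) (2^-1 * k z s)%:E = (2^-1 * (pi / 2 * `|z|))%:E)%E.
  under eq_integral do rewrite EFinM.
  transitivity (2^-1%:E * \int[mu]_(s in D) (k z s)%:E)%E; last by rewrite kE.
  have h0 : (0 <= (2^-1 : R)%:E)%E by rewrite lee_fin invr_ge0.
  exact: (@ge0_integralZl _ _ _ mu D (measurable_itv _) (EFin \o k z) (mk z) _ (k0 z) h0).
have mhk z : measurable_fun D (fun s => (2^-1 * k z s)%:E).
  by apply/measurable_EFinP/measurable_funM => //; apply/measurable_EFinP; exact: mk.
have hk0 z s : D s -> (0 <= (2^-1 * k z s)%:E)%E.
  by move=> _; rewrite lee_fin mulr_ge0 ?invr_ge0 ?kernel_ge0.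
have e2 : (\int[mu]_(s in D) (P s)%:E +
    (2^-1 * (pi / 2 * `|(x + y)%R|) + 2^-1 * (pi / 2 * `|(x - y)%R|))%:E =
    (pi / 2 * x + pi / 2 * y)%:E)%E.
  have h1 := @ge0_integralD _ _ _ mu D (measurable_itv _) _ _ (hk0 (x + y)) (mhk (x + y))
    (hk0 (x - y)) (mhk (x - y)).
  have h2 := @ge0_integralD _ _ _ mu D (measurable_itv _) _ _ P0 mP
    (fun s Ds => adde_ge0 (hk0 (x + y) s Ds) (hk0 (x - y) s Ds))
    (emeasurable_funD (mhk (x + y)) (mhk (x - y))).
  rewrite EFinD -!half -h1 -h2 -e1.
  by apply: eq_integral => s _; rewrite -!EFinD kP.
have -> : (\int[mu]_(s in D) (P s)%:E =
  (pi / 2 * x + pi / 2 * y)%:E - (2^-1 * (pi / 2 * `|(x + y)%R|) +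
    2^-1 * (pi / 2 * `|(x - y)%R|))%:E)%E by rewrite -e2 addeK.
(* The minimum arises as x + y - (|x + y| + |x - y|) / 2 for nonnegative x and y. *)
rewrite -EFinB; congr (_%:E); rewrite (ger0_norm (addr_ge0 x0 y0)).
have [xy|xy] := leP x y.
  by rewrite ler0_norm ?subr_le0//; field.
by rewrite ger0_norm ?subr_ge0 ?(ltW xy)//; field.
Qed.

End CauchyCosine.

(** * Cosine transform of the Cauchy density *)

Section CauchyCosineTransform.
Variable R : realType.
Notation mu := (@lebesgue_measure R).
Local Notation D := (`[0%R, +oo[%classic : set R).

Let derivable_cts (f : R -> R) x : derivable f x 1 -> {for x, continuous f}.
Proof. by move=> df; apply/differentiable_continuous/derivable1_diffP. Qed.

(** The outer integral that Tonelli's theorem leaves in the next lemma; the minimum is the value of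
    the integral of the product of two factors 1 - cos. *)
Lemma integral_expRN_min (t y : R) : 0 < t -> 0 < y ->
  (\int[mu]_(x in D) (expR (- (x * t)) * Num.min x y)%:E =
   ((1 - expR (- (y * t))) / t ^+ 2)%:E)%E.
Proof.
move=> t0 y0.
have mf : measurable_fun setT (fun x : R => (expR (- (x * t)) * Num.min x y)%:E).
  apply/measurable_EFinP; apply: measurable_funM; last exact: measurable_minr.
  apply: measurableT_comp; first exact: measurable_expR.
  by apply: measurable_funN; exact: measurable_funM.
have -> : D = `[0, y] `|` `]y, +oo[ :> set R.
  by rewrite -itv_bndbnd_setU// bnd_simp ltW.
rewrite integral_setU//=; last 2 first.
- exact: (measurable_funS measurableT).
- rewrite disj_set2E; apply/eqP/seteqP; split => // x /=.
  by rewrite !in_itv/= andbT => -[/andP[_ x0]]; rewrite ltNge x0.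
have -> : (\int[mu]_(x in `[0%R, y]) (expR (- (x * t)) * Num.min x y)%:E =
    (t ^- 2 - (t^-1 * y + t ^- 2) * expR (- (y * t)))%:E)%E.
  pose F (x : R) := - ((t^-1 * x + t ^- 2) * expR (- (x * t))).
  have dF (x : R) : is_derive x 1 F (expR (- (x * t)) * x).
    apply: is_derive_eq; rewrite /GRing.scale/=; move: (expR _) => e.
    by field; rewrite gt_eqF.
  rewrite (_ : (\int[mu]_(x in `[0%R, y]) _ =
      \int[mu]_(x in `[0%R, y]) (expR (- (x * t)) * x)%:E)%E); last first.
    apply: eq_integral => x; rewrite inE/= in_itv/= => /andP[_ xy].
    by rewrite min_l.
  rewrite (@continuous_FTC2 _ (fun x => expR (- (x * t)) * x) F 0 y)//.
  - rewrite -EFinB /F mul0r oppr0 expR0 mulr0 add0r mulr1 opprK addrC.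
    by [].
  - apply: continuous_subspaceT => x; apply: derivable_cts; exact: ex_derive.
  - split.
    + by move=> x _; have [] := dF x.
    + by apply: cvg_at_right_filter; apply: derivable_cts; have [] := dF 0.
    + by apply: cvg_at_left_filter; apply: derivable_cts; have [] := dF y.
  - by move=> x _; rewrite derive1E; apply: derive_val; exact: dF.
rewrite integral_itv_obnd_cbnd; last exact: measurable_funTS.
have -> : (\int[mu]_(x in `[y, +oo[) (expR (- (x * t)) * Num.min x y)%:E =
    (t^-1 * y * expR (- (y * t)))%:E)%E.
  pose F (x : R) := - (t^-1 * y) * expR (- (x * t)).
  have dF (x : R) : is_derive x 1 F (expR (- (x * t)) * y).
    apply: is_derive_eq; rewrite /GRing.scale/=; move: (expR _) => e.
    by field; rewrite gt_eqF.
  rewrite (_ : (\int[mu]_(x in `[y, +oo[) _ =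
      \int[mu]_(x in `[y, +oo[) (expR (- (x * t)) * y)%:E)%E); last first.
    apply: eq_integral => x; rewrite inE/= in_itv/= andbT => yx.
    by rewrite min_r.
  rewrite (@ge0_continuous_FTC2y _ (fun x => expR (- (x * t)) * y) F y 0)//.
  - by rewrite sub0e -EFinN /F mulNr opprK.
  - by move=> x _; rewrite mulr_ge0 ?expR_ge0// ltW.
  - apply: continuous_subspaceT => x; apply: derivable_cts; exact: ex_derive.
  - rewrite -[X in _ --> X](mulr0 (- (t^-1 * y))).
    by apply: cvgM; [exact: cvg_cst|exact: cvgy_expRN].
  - by apply: cvg_at_right_filter; apply: derivable_cts; have [] := dF y.
  - by move=> x _; rewrite derive1E; apply: derive_val; exact: dF.
rewrite -EFinD; congr (_%:E); move: (expR _) => e; field.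
by rewrite gt_eqF.
Qed.

(* Tonelli, from
   [s^2 / (s^2 + t^2) = t \int_0^oo e^(-xt) (1 - cos (sx)) dx]. *)
Lemma integral_one_sub_cos_cauchy (t xi : R) : 0 < t -> 0 <= xi ->
  (\int[mu]_(s in D) ((1 - cos (s * xi)) / (s ^+ 2 + t ^+ 2))%:E =
   (pi / (2 * t) * (1 - expR (- (xi * t))))%:E)%E.
Proof.
move=> t0; rewrite le_eqVlt => /predU1P[<-|xi0].
  rewrite mul0r oppr0 expR0 subrr mulr0; apply: integral0_eq => s _.
  by rewrite mulr0 cos0 subrr mul0r.
pose f s x : R := t * expR (- (x * t)) *
  ((1 - cos (s * xi)) * (1 - cos (s * x)) / s ^+ 2).
have minv d (S : measurableType d) (h : S -> R) :
  measurable_fun setT h -> measurable_fun setT (fun x => h x ^- 2).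
  move=> mh; apply: measurableT_comp; first exact: measurable_inv.
  exact: measurable_funX.
have mf : measurable_fun setT
    (fun z : measurableTypeR R * measurableTypeR R => f z.1 z.2).
  apply: measurable_funM.
    apply: measurable_funM => //.
    apply: measurableT_comp; first exact: measurable_expR.
    by apply: measurable_funN; exact: measurable_funM.
  apply: measurable_funM; last exact: minv.
  by apply: measurable_funM; apply: measurable_one_sub_cos; exact: measurable_funM.
have f0 s x : 0 <= s -> 0 <= x -> 0 <= f s x.
  move=> s0 x0; apply: mulr_ge0; first by rewrite mulr_ge0 ?expR_ge0// ltW.
  by rewrite divr_ge0 ?sqr_ge0// mulr_ge0.
transitivity (\int[mu]_(s in D) \int[mu]_(x in D) (f s x)%:E)%E.
  apply: eq_integral => s; rewrite inE/= in_itv/= andbT le_eqVlt => /predU1P[<-|s0].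
    rewrite mul0r cos0 subrr mul0r; apply/esym/integral0_eq => x _.
    by rewrite /f mul0r cos0 subrr !mul0r mulr0.
  apply/esym/integral_half_line_primitive => [x x0|x x0|].
  - by apply: f0 => //; exact: ltW.
  - by apply: derivable_cts; exact: ex_derive.
  - have h := half_line_primitive_expRN_cos s t0.
    have := half_line_primitive_linear (t * (1 - cos (s * xi)) / s ^+ 2) 0 h h.
    rewrite mul0r addr0.
    have -> : t * (1 - cos (s * xi)) / s ^+ 2 * (t^-1 - t / (t ^+ 2 + s ^+ 2)) =
        (1 - cos (s * xi)) / (s ^+ 2 + t ^+ 2).
      move: (1 - cos (s * xi)) => c; field.
      by rewrite !gt_eqF// addr_gt0 ?exprn_gt0.
    apply: eq_half_line_primitive => x _.
    by rewrite mul0r addr0 /f (mulrC s x); ring.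
rewrite half_line_tonelli//.
have min0 x : 0 <= x -> 0 <= Num.min x xi by move=> x0; rewrite le_min x0 ltW.
(* With x fixed, the integral over s is the product formula, equal to (pi / 2) min (x, xi). *)
transitivity (\int[mu]_(x in D) ((pi / 2 * t)%:E * (expR (- (x * t)) * Num.min x xi)%:E))%E.
  apply: eq_integral => x; rewrite inE/= in_itv/= andbT => x0.
  have := integral_one_sub_cos_mul x0 (ltW xi0).
  pose P s : R := (1 - cos (s * xi)) * (1 - cos (s * x)) / s ^+ 2.
  rewrite -/(P _) => e.
  have P0 s : D s -> (0 <= (P s)%:E)%E.
    by move=> _; rewrite lee_fin divr_ge0 ?sqr_ge0// mulr_ge0.
  have mP : measurable_fun D (EFin \o P).
    apply/measurable_EFinP; apply: measurable_funTS.
    apply: measurable_funM; last exact: minv.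
    by apply: measurable_funM; apply: measurable_one_sub_cos; exact: measurable_funM.
  have c0 : (0 <= (t * expR (- (x * t)))%:E)%E.
    by rewrite lee_fin mulr_ge0 ?expR_ge0// ltW.
  have := @ge0_integralZl _ _ _ mu D (measurable_itv _) (EFin \o P) mP _ P0 c0.
  rewrite /= e => h; rewrite -[LHS]/(\int[mu]_(s in D) ((t * expR (- (x * t)))%:E * (P s)%:E))%E h.
  by rewrite -!EFinM; congr (_%:E); ring.
have p0 : (0 <= (pi / 2 * t)%:E)%E.
  by rewrite lee_fin mulr_ge0 ?divr_ge0 ?pi_ge0// ltW.
have g0 x : D x -> (0 <= (expR (- (x * t)) * Num.min x xi)%:E)%E.
  by rewrite /= in_itv/= andbT => x0; rewrite lee_fin mulr_ge0 ?expR_ge0// min0.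
have mg : measurable_fun D (fun x : R => (expR (- (x * t)) * Num.min x xi)%:E).
  apply/measurable_EFinP; apply: measurable_funTS.
  apply: measurable_funM; last exact: measurable_minr.
  apply: measurableT_comp; first exact: measurable_expR.
  by apply: measurable_funN; exact: measurable_funM.
have := @ge0_integralZl _ _ _ mu D (measurable_itv _) _ mg _ g0 p0.
move=> ->; rewrite integral_expRN_min// -EFinM; congr (_%:E).
move: (@pi R) (expR _) => q e; field.
by rewrite gt_eqF.
Qed.

End CauchyCosineTransform.

(** * Levy measures *)

Section CauchyLaw.
Variable R : realType.
Notation leb := (@lebesgue_measure R).
Local Notation D := (`[0%R, +oo[%classic : set R).
Local Open Scope complex_scope.

Let measurable_inv_sqr (c : R) : measurable_fun setT (fun s : R => (s ^+ 2 + c)^-1).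
Proof.
apply: measurableT_comp; first exact: measurable_inv.
by apply: measurable_funD => //; exact: measurable_funX.
Qed.

Let measurable_sub_cos (xi : R) : measurable_fun setT (fun s : R => 1 - cos (s * xi)).
Proof. by apply: measurable_one_sub_cos; exact: measurable_funM. Qed.

Let cos_norm (s xi : R) : cos (s * xi) = cos (s * `|xi|).
Proof. by case: (ger0P xi) => // _; rewrite mulrN cosN. Qed.

Lemma cauchy_pdf_ge0 (t s : R) : 0 < t -> 0 <= cauchy_pdf t s.
Proof.
move=> t0; rewrite /cauchy_pdf mulr_ge0//.
  by rewrite divr_ge0// pi_ge0.
by rewrite divr_ge0 ?addr_ge0 ?sqr_ge0// ltW.
Qed.

Lemma measurable_cauchy_pdf (t : R) : measurable_fun setT (cauchy_pdf t).
Proof.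
by apply: measurable_funM => //; apply: measurable_funM => //; exact: measurable_inv_sqr.
Qed.

Lemma cauchy_symmetric (t : R) (mu : realLaw R) : 0 < t ->
  has_density mu (cauchy_pdf t) -> symmetric_measure mu.
Proof.
move=> t0 muE; apply: (density_symmetric muE).
- exact: measurable_cauchy_pdf.
- by move=> s; exact: cauchy_pdf_ge0.
- by move=> s; rewrite /cauchy_pdf sqrrN.
Qed.

Lemma integral_one_sub_cos_cauchy_law (t xi : R) (mu : realLaw R) : 0 < t ->
  has_density mu (cauchy_pdf t) ->
  (\int[mu]_s (1 - cos (s * xi))%:E = (1 - expR (- (t * `|xi|)))%:E)%E.
Proof.
move=> t0 muE.
have mg : measurable_fun setT (fun s : R => (1 - cos (s * xi))%:E).
  by apply/measurable_EFinP; exact: measurable_sub_cos.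
have g0 (s : R) : (0 <= (1 - cos (s * xi))%:E)%E by rewrite lee_fin.
rewrite (ge0_integral_density muE (@measurable_cauchy_pdf t)
  (fun s => cauchy_pdf_ge0 s t0) mg g0).
rewrite ge0_integral_even; last 3 first.
- apply: emeasurable_funM => //; apply/measurable_EFinP.
  exact: measurable_cauchy_pdf.
- by move=> s; rewrite -EFinM lee_fin mulr_ge0// cauchy_pdf_ge0.
- by move=> s; rewrite mulNr cosN /cauchy_pdf sqrrN.
pose k s : R := (1 - cos (s * `|xi|)) / (s ^+ 2 + t ^+ 2).
have mk : measurable_fun D (EFin \o k).
  apply/measurable_EFinP; apply: measurable_funTS.
  by apply: measurable_funM; [exact: measurable_sub_cos|exact: measurable_inv_sqr].
have k0 s : D s -> (0 <= (k s)%:E)%E.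
  by move=> _; rewrite lee_fin divr_ge0// addr_ge0 ?sqr_ge0.
have c0 : (0 <= (t / pi)%:E)%E by rewrite lee_fin divr_ge0 ?pi_ge0// ltW.
have := @ge0_integralZl _ _ _ leb D (measurable_itv _) (EFin \o k) mk _ k0 c0.
rewrite (integral_one_sub_cos_cauchy t0 (normr_ge0 xi) :
  (\int[leb]_(s in D) (EFin \o k) s = _)%E).
move=> h; rewrite [X in (2%:E * X)%E](_ : _ =
    (\int[leb]_(s in D) ((t / pi)%:E * (EFin \o k) s))%E); last first.
  apply: eq_integral => s _; rewrite /= -!EFinM cos_norm /k /cauchy_pdf.
  by congr (_%:E); ring.
rewrite h -!EFinM; congr (_%:E); rewrite (mulrC t `|xi|).
have := @pi_gt0 R; move: (@pi R) (expR _) => q e q0; field.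
by rewrite !gt_eqF.
Qed.

(** The real part is 1 minus the integral of 1 - cos; the imaginary part vanishes because the sine
    is odd and the law symmetric. *)
Lemma char_fun_cauchy (t xi : R) (mu : realLaw R) : 0 < t ->
  has_density mu (cauchy_pdf t) -> char_fun mu xi = (expR (- (t * `|xi|)))%:C.
Proof.
move=> t0 muE.
have mus := cauchy_symmetric t0 muE.
have cM : continuous (fun s : R => s * xi).
  by move=> s; apply: cvgM; [exact: cvg_id|exact: cvg_cst].
have cs : continuous (fun s : R => sin (s * xi)).
  by move=> s; apply: continuous_comp; [exact: cM|exact: continuous_sin].
rewrite /char_fun /Cintegral; congr (_ +i* _) => /=.
- rewrite (_ : (fun s => cos (s * xi)) = (fun s : R => 1 - (1 - cos (s * xi)))); last first.
    by apply/funext => s; rewrite subKr.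
  have i1 : mu.-integrable setT (EFin \o (fun s => 1 - cos (s * xi))).
    apply/integrableP; split; first by apply/measurable_EFinP; exact: measurable_sub_cos.
    under eq_integral do rewrite /= ger0_norm//.
    by rewrite (integral_one_sub_cos_cauchy_law xi t0 muE) ltry.
  rewrite (RintegralB measurableT (finite_measure_integrable_cst mu 1 measurableT) i1).
  have -> : \int[mu]_s (cst 1 s) = 1 :> R.
    rewrite Rintegral_cst// mul1r; exact: (congr1 fine (probability_setT mu)).
  by rewrite /Rintegral (integral_one_sub_cos_cauchy_law xi t0 muE)/= subKr.
- have e := @Rintegral_symmetric _ mu _ mus cs.
  have : \int[mu]_s sin (- s * xi) = \int[mu]_s sin (s * xi).
    by apply: e; exists 1 => s; exact: sin_max.
  under eq_Rintegral do rewrite mulNr sinN -mulN1r.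
  rewrite RintegralZl//; last first.
    apply: measurable_bounded_integrable => //.
    - by apply: (@le_lt_trans _ _ 1%E); [rewrite -(probability_setT mu)|exact: ltry].
    - exact: continuous_measurable_fun.
    - exists 1; split; [exact: num_real|move=> x x1 s _].
      exact: le_trans (sin_max _) (ltW x1).
  by rewrite mulN1r => /eqP; rewrite eq_sym -addr_eq0 -mulr2n mulrn_eq0 => /eqP.
Qed.

Lemma measurable_levy_kernel (xi : R) : measurable_fun setT (levy_kernel xi).
Proof.
(* The quotient formula gives 0 at s = 0, and the indicator term restores the prescribed value
   there. *)
rewrite (_ : levy_kernel xi = (fun s => (cos (s * xi) - 1) * ((1 + s ^+ 2) / s ^+ 2) +
    - (xi ^+ 2 / 2) * \1_[set 0] s)); last first.
  apply/funext => s; rewrite /levy_kernel indicE.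
  case: eqP => [->|/eqP s0].
    by rewrite mem_set//= mul0r cos0 subrr mul0r add0r mulr1.
  by rewrite memNset/= ?mulr0 ?addr0//; exact/eqP.
apply: measurable_funD; last by apply: measurable_funM => //; exact: measurable_indic.
apply: measurable_funM.
  apply: measurable_funB => //; apply: measurableT_comp; last exact: measurable_funM.
  by apply: continuous_measurable_fun; exact: continuous_cos.
apply: measurable_funM; first by apply: measurable_funD => //; exact: measurable_funX.
by apply: measurableT_comp; [exact: measurable_inv|exact: measurable_funX].
Qed.

(* Off the origin this is [t/pi * 1/(1+s^2)], the Levy density of the context;
   the value at the null point 0 is immaterial. *)
Definition cauchy_levy_pdf (t s : R) : R := t * gap_pdf 0 1 s.

Variable t : R.
Hypothesis t0 : 0 < t.

Lemma cauchy_levy_pdf_ge0 s : 0 <= cauchy_levy_pdf t s.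
Proof. by rewrite /cauchy_levy_pdf mulr_ge0 ?gap_pdf_ge0// ltW. Qed.

Lemma measurable_cauchy_levy_pdf : measurable_fun setT (cauchy_levy_pdf t).
Proof. by apply: measurable_funM => //; exact: measurable_gap_pdf. Qed.

Lemma exists_cauchy_levy_measure :
  exists G : finiteMeasureR R, has_density G (cauchy_levy_pdf t).
Proof.
apply: exists_density_measure; first exact: cauchy_levy_pdf_ge0.
exact: (integrableZl measurableT t (integrable_gap_pdf (lexx 0) ltr01 ler01)).
Qed.

Variable G : finiteMeasureR R.
Hypothesis GE : has_density G (cauchy_levy_pdf t).

Lemma cauchy_levy_symmetric : symmetric_measure G.
Proof.
apply: (density_symmetric GE).
- exact: measurable_cauchy_levy_pdf.
- exact: cauchy_levy_pdf_ge0.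
- by move=> s; rewrite /cauchy_levy_pdf gap_pdfN.
Qed.

(** The factors 1 + s^2 cancel. At s = 0 the left side vanishes because the density excludes the
    degenerate interval [-0, 0], the right side because 1 - cos 0 = 0. *)
Lemma levy_kernel_pdf (xi s : R) : levy_kernel xi s * cauchy_levy_pdf t s =
  - (t / pi * ((1 - cos (s * `|xi|)) / s ^+ 2)).
Proof.
rewrite /levy_kernel /cauchy_levy_pdf /gap_pdf indicE oppr0 set_itv1.
case: eqP => [->|/eqP s0].
  by rewrite memNset/=; [rewrite !mul0r !mulr0 cos0 subrr !mul0r mulr0 oppr0|apply].
rewrite mem_set/=; last by apply/eqP.
rewrite -cos_norm expr0n/= mul0r !subr0 sqrtr1 mulr1 mul1r add0r expr1n.
have s1 : 1 + s ^+ 2 != 0 by rewrite gt_eqF// ltr_pwDl ?sqr_ge0.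
have := @pi_gt0 R; move: (@pi R) (cos _) => q e q0; field.
by rewrite s1 s0 gt_eqF.
Qed.

Lemma integral_levy_kernel (xi : R) : \int[G]_s levy_kernel xi s = - (t * `|xi|).
Proof.
rewrite /Rintegral (integral_density GE); last 3 first.
- exact: measurable_cauchy_levy_pdf.
- exact: cauchy_levy_pdf_ge0.
- by apply/measurable_EFinP; exact: measurable_levy_kernel.
under eq_integral do rewrite -EFinM levy_kernel_pdf EFinN EFinM.
pose k s : R := (1 - cos (s * `|xi|)) / s ^+ 2.
have k0 s : 0 <= k s by rewrite divr_ge0 ?sqr_ge0.
have mk : measurable_fun setT (EFin \o k).
  apply/measurable_EFinP; apply: measurable_funM; first exact: measurable_sub_cos.
  by apply: measurableT_comp; [exact: measurable_inv|exact: measurable_funX].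
have c0 : (0 <= (t / pi)%:E)%E by rewrite lee_fin divr_ge0 ?pi_ge0// ltW.
rewrite integral_ge0N; last first.
  by move=> s _; apply: mule_ge0 => //; rewrite lee_fin; exact: k0.
have k0' s : setT s -> (0 <= (EFin \o k) s)%E by move=> _; rewrite lee_fin.
have := @ge0_integralZl _ _ _ leb setT measurableT (EFin \o k) mk _ k0' c0.
rewrite (@ge0_integral_even _ (EFin \o k) mk); last 2 first.
- by move=> s; rewrite lee_fin.
- by move=> s; rewrite /= /k mulNr cosN sqrrN.
rewrite (integral_one_sub_cos_div_sqr `|xi| :
  (\int[leb]_(s in D) (EFin \o k) s = _)%E).
move=> ->; rewrite /= normr_id; congr (- _).
have := @pi_gt0 R; move: (@pi R) => q q0; field.
by rewrite gt_eqF.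
Qed.

Lemma is_levy_measure_cauchy (mu : realLaw R) :
  has_density mu (cauchy_pdf t) -> is_levy_measure mu G.
Proof.
move=> muE; split; [exact: cauchy_symmetric muE|exact: cauchy_levy_symmetric|].
by move=> xi; rewrite (char_fun_cauchy xi t0 muE) integral_levy_kernel.
Qed.

End CauchyLaw.

(** * The R-transform given by the Levy measure *)

Section LevyTransform.
Variable R : realType.
Local Open Scope complex_scope.

Variables (t : R) (G : finiteMeasureR R).
Hypothesis t0 : 0 < t.
Hypothesis GE : has_density G (cauchy_levy_pdf t).

(** Transfers integrals against the Levy measure to the gap law with a = 0 and b = 1, whose
    resolvent is known. *)
Lemma Cintegral_cauchy_levy (nu : realLaw R) (g : R -> R[i]) :
  has_density nu (gap_pdf 0 1) -> tame g -> Cintegral G g = t%:C * Cintegral nu g.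
Proof.
move=> nuE [g1 g2 [M gM]].
have scale (f : R -> R) : continuous f -> (forall s, `|f s| <= M) ->
    \int[G]_s f s = t * \int[nu]_s f s.
  move=> cf fM.
  have mf : measurable_fun setT (EFin \o f).
    by apply/measurable_EFinP; exact: continuous_measurable_fun.
  have fi : (@lebesgue_measure R).-integrable setT (EFin \o (fun s => f s * gap_pdf 0 1 s)).
    apply: (integrableMr measurableT _ _ (integrable_gap_pdf (lexx 0) ltr01 ler01)).
      exact: continuous_measurable_fun.
    by exists M; split; [exact: num_real|move=> x Mx y _; exact: le_trans (fM y) (ltW Mx)].
  rewrite /Rintegral (integral_density GE (measurable_cauchy_levy_pdf t)
    (cauchy_levy_pdf_ge0 t0) mf).
  rewrite (integral_density nuE (measurable_gap_pdf 0 1) (gap_pdf_ge0 (lexx 0) ltr01 ler01) mf).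
  rewrite -/(Rintegral _ _ (fun s => f s * gap_pdf 0 1 s)) -RintegralZl//.
  congr fine; apply: eq_integral => s _; rewrite -EFinM; congr (_%:E).
  by rewrite /cauchy_levy_pdf; ring.
apply/eqP; rewrite eq_complex /= !mul0r subr0 addr0; apply/andP; split; apply/eqP.
- by apply: scale => // s; have [] := gM s.
- by apply: scale => // s; have [] := gM s.
Qed.

(** With p = 1 / w, so z = -p^-2, the integrand is p^2 + p^2 (1 - p^2) / (p^2 + s^2). The resolvent
    formula with a = 0, b = 1 and E = p gives 1 / (p (p + 1)), so the integral is t (p^2 + p (1 -
    p)) = t p. The bound Re p > 1 keeps E away from b. *)
Lemma cauchy_levy_transform (z : R[i]) (w := sqrtc (- z)) : 0 < complex.Re w ->
  1 < complex.Re w^-1 ->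
  z * Cintegral G (fun s => (1 + s ^+ 2)%:C / (1 - z * (s ^+ 2)%:C)) = - t%:C * w.
Proof.
move=> w0 q1; have wnz := Re_gt0_neq0 w0.
have q0 := Re_inv_gt0 w0.
have [nu nuE] := exists_gap_law (lexx (0 : R)) ltr01 ler01.
have zE : z = - w ^+ 2 by rewrite sqr_sqrtc opprK.
set p := w^-1 in q0 q1.
have pnz := Re_gt0_neq0 q0.
have tp := tame_resolvent q0.
have t1 := tame_cst (1 : R[i]).
rewrite (@eq_Cintegral _ G _ (fun s => p ^+ 2 * 1 +
   p ^+ 2 * (1 - p ^+ 2) * (p ^+ 2 + (s ^+ 2)%:C)^-1)); last first.
  move=> s; have ps : p ^+ 2 + (s ^+ 2)%:C != 0.
    rewrite addr_eq0 -rmorphN; apply: sqr_neq_real => //.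
    by rewrite (@le_lt_trans _ _ 0) ?oppr_le0 ?sqr_ge0// exprn_gt0.
  rewrite zE -[w]invrK -/p rmorphD rmorph1 /=; move: ((s ^+ 2)%:C) ps => S ps.
  by field; rewrite pnz ps.
rewrite (Cintegral_cauchy_levy nuE (tame_linear _ _ t1 tp)).
rewrite (@Cintegral_linear _ nu _ _ _ _ t1 tp).
have pE : p ^+ 2 = p ^+ 2 + (0 ^+ 2)%:C by rewrite expr0n addr0.
have p1 : p ^+ 2 != (1 ^+ 2)%:C.
  by apply: sqr_neq_real => //; rewrite ltr_sqr ?nnegrE// ltW.
rewrite (Cintegral_gap_resolvent (lexx 0) ltr01 ler01 nuE q0 q0 pE p1).
have -> : Cintegral nu (fun=> 1) = 1.
  rewrite /Cintegral /= Rintegral_cst// mul1r; congr (_ +i* _).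
    exact: (congr1 fine (probability_setT nu)).
  by rewrite Rintegral_cst// mul0r.
have pp1 : p + 1 != 0 by rewrite Re_gt0_neq0// Re_add addr_gt0//= ltr01.
have -> : w = p^-1 by rewrite invrK.
rewrite zE -[w]invrK -/p rmorph0 addr0 rmorph1; field.
by rewrite pnz pp1.
Qed.

End LevyTransform.

(** * Support and infinite divisibility *)

Section Support.
Variable R : realType.

(** The open gap is a null neighbourhood of each of its points. Around any other point lies an open
    interval on which the density is positive; were its measure 0, the density would vanish almost
    everywhere there, making the interval Lebesgue-null. *)
Lemma gap_law_support (a b : R) (nu : realLaw R) : 0 <= a -> 0 < b -> a <= b ->
  has_density nu (gap_pdf a b) -> measure_support nu = ~` `](- a), a[.
Proof.
move=> a0 b0 ab nuE.
have apb : 0 < a + b by exact: ltr_wpDl.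
have pdf_gt0 (s : R) : a < `|s| -> 0 < gap_pdf a b s.
  move=> as_; have s0 : 0 < `|s| := le_lt_trans a0 as_.
  have sa : a ^+ 2 < s ^+ 2.
    by rewrite -[s ^+ 2]real_normK ?num_real// ltr_sqr ?nnegrE// ltW.
  rewrite /gap_pdf indicE mem_set ?mul1r; last first.
    by move=> /=; rewrite in_itv/= -ler_norml leNgt as_.
  rewrite mulr_gt0//.
    rewrite divr_gt0// mulr_gt0 ?pi_gt0//.
    by rewrite ltr_wpDl ?subr_ge0 ?ler_sqr ?nnegrE ?(ltW b0)// (le_lt_trans _ sa) ?sqr_ge0.
  rewrite sqrtr_gt0 subr_gt0 ltr_pdivrMr ?mul1r//.
  by rewrite (le_lt_trans _ sa)// sqr_ge0.
have mgap := measurable_gap_pdf a b.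
have gap0 := gap_pdf_ge0 a0 b0 ab.
apply/seteqP; split=> [x xS /= xa|x /= xa V oV Vx].
  have oI : open (`]- a, a[%classic : set R) by exact: interval_open.
  have := xS _ oI xa.
  rewrite nuE; last exact: measurable_itv.
  rewrite integral0_eq ?ltxx// => s /=; rewrite in_itv/= => /andP[s1 s2].
  rewrite /gap_pdf indicE memNset ?mul0r//=; apply; rewrite in_itv/=.
  by rewrite !ltW.
have key (c d : R) : c < d -> `]c, d[ `<=` V ->
    (forall s, c < s < d -> a < `|s|) -> (0 < nu V)%E.
  move=> cd cdV H.
  have mV : measurable (V : set (measurableTypeR R)) by exact: open_measurable.
  have mI : measurable (`]c, d[%classic : set (measurableTypeR R)) by exact: measurable_itv.
  apply: (@lt_le_trans _ _ (nu `]c, d[%classic)); last by apply: le_measure; rewrite ?inE.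
  rewrite lt0e measure_ge0 andbT nuE//; apply/eqP => I0.
  have mfI : measurable_fun `]c, d[ (EFin \o gap_pdf a b).
    by apply/measurable_EFinP; exact: measurable_funTS.
  have : (\int[@lebesgue_measure R]_(s in `]c, d[) `|(EFin \o gap_pdf a b) s| = 0)%E.
    by rewrite -I0; apply: eq_integral => s _; rewrite /= ger0_norm.
  move/(ae_eq_integral_abs _ mI mfI) => [N [mN N0 sub]].
  have IN : `]c, d[ `<=` N.
    move=> s Is; apply: sub => /= /(_ Is) /eqP; rewrite eqe gt_eqF//.
    by apply: pdf_gt0; apply: H; move: Is; rewrite /= in_itv.
  have IN' : (@lebesgue_measure R `]c, d[%classic <= @lebesgue_measure R N)%E.
    exact: (le_measure (@lebesgue_measure R) (mem_set mI) (mem_set mN) IN).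
  have N0' : (@lebesgue_measure R N <= 0)%E by rewrite N0.
  move: (le_trans IN' N0'); rewrite lebesgue_measure_itv/= lte_fin cd -EFinB lee_fin.
  by rewrite subr_le0 leNgt cd.
have [e /= e0 eV] := (nbhs_ballP _ _).1 (open_nbhs_nbhs (conj oV Vx)).
have ax : a <= `|x|.
  by rewrite leNgt; apply/negP => xa'; apply: xa; rewrite in_itv/= -ltr_norml.
(* The interval is taken on the side of x away from 0, since x may be an endpoint of the gap. *)
have [x0|x0] := leP 0 x.
  apply: (key x (x + e)); first by rewrite ltrDl.
    move=> s /=; rewrite in_itv/= => /andP[xs sxe]; apply: eV.
    by rewrite /ball/= ltr_distlC; apply/andP; split; lra.
  move=> s /andP[xs _]; rewrite (le_lt_trans ax)// !ger0_norm//.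
  exact: le_trans (ltW xs).
apply: (key (x - e) x); first by rewrite ltrBlDr ltrDl.
  move=> s /=; rewrite in_itv/= => /andP[xs sxe]; apply: eV.
  by rewrite /ball/= ltr_distlC; apply/andP; split; lra.
move=> s /andP[_ sx]; rewrite (le_lt_trans ax)// ltr0_norm// ltr0_norm ?ltrN2//.
exact: lt_trans x0.
Qed.

End Support.

(** * Rectangular convolution powers and the Levy measure of the explicit law *)

Section InfiniteDivisibility.
Variable R : realType.
Local Open Scope complex_scope.
Variable lambda : R.
Hypothesis l01 : 0 <= lambda <= 1.

Lemma exists_rect_cauchy_law (t : R) : 0 < t ->
  exists nu : realLaw R, has_density nu (rect_cauchy_pdf lambda t).
Proof.
move=> t0; have /andP[l0 l1] := l01.
rewrite rect_cauchy_pdfE; apply: exists_gap_law.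
- by rewrite divr_ge0// mulr_ge0 ?subr_ge0// ltW.
- by rewrite divr_gt0// mulr_gt0// ltr_pwDl.
- have := mulr_ge0 (ltW t0) l0; lra.
Qed.

Lemma rect_cauchy_symmetric (t : R) (nu : realLaw R) : 0 < t ->
  has_density nu (rect_cauchy_pdf lambda t) -> symmetric_measure nu.
Proof.
move=> t0; have /andP[l0 l1] := l01.
rewrite rect_cauchy_pdfE; apply: gap_law_symmetric.
- by rewrite divr_ge0// mulr_ge0 ?subr_ge0// ltW.
- by rewrite divr_gt0// mulr_gt0// ltr_pwDl.
- have := mulr_ge0 (ltW t0) l0; lra.
Qed.

Lemma rect_conv_cauchy (s t : R) (mu nu rho : realLaw R) : 0 < s -> 0 < t ->
  has_density mu (rect_cauchy_pdf lambda s) ->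
  has_density nu (rect_cauchy_pdf lambda t) ->
  has_density rho (rect_cauchy_pdf lambda (s + t)) ->
  is_rect_conv lambda mu nu rho.
Proof.
move=> s0 t0 muE nuE rhoE; have st0 : 0 < s + t by rewrite addr_gt0.
split; [exact: rect_cauchy_symmetric muE|exact: rect_cauchy_symmetric nuE|
  exact: rect_cauchy_symmetric rhoE|].
have refl (f : R[i] -> R[i]) : germ_eq f f by move=> alpha _; exists 1.
exists (fun z => - s%:C * sqrtc (- z)), (fun z => - t%:C * sqrtc (- z)); split.
- exact: (rect_R_transform_rect_cauchy l01 s0 muE).
- exact: (rect_R_transform_rect_cauchy l01 t0 nuE).
- apply: (rect_R_transform_rect_cauchy l01 st0 rhoE) => alpha _; exists 1 => // z _.
  by rewrite -mulrDl -opprD -rmorphD.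
Qed.

(** The induction starts at the second power: [rect_power1] relates [nu] only to itself, while here
    [rho] is any law with the right density. From two factors on, [rect_powerS] accepts every such
    law. *)
Lemma rect_power_cauchy (n : nat) (t : R) (nu rho : realLaw R) : 0 < t ->
  has_density nu (rect_cauchy_pdf lambda t) ->
  has_density rho (rect_cauchy_pdf lambda (n.+2%:R * t)) ->
  is_rect_power lambda nu n.+2 rho.
Proof.
move=> t0 nuE; elim: n rho => [|n IHn] rho rhoE.
  apply: (rect_powerS (rect_power1 lambda nu)).
  apply: (rect_conv_cauchy t0 t0) => //.
  by move: rhoE; rewrite mulrDl mul1r.
have t1 : 0 < n.+2%:R * t by rewrite mulr_gt0.
have [sigma sigmaE] := exists_rect_cauchy_law t1.
apply: (rect_powerS (IHn _ sigmaE)).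
apply: (rect_conv_cauchy t1 t0) => //.
by move: rhoE; rewrite -[n.+3%:R]natr1 mulrDl mul1r.
Qed.

Lemma rect_infdiv_cauchy (t : R) (nu : realLaw R) : 0 < t ->
  has_density nu (rect_cauchy_pdf lambda t) -> rect_infdiv lambda nu.
Proof.
move=> t0 nuE; split; first exact: rect_cauchy_symmetric nuE.
move=> [//|[|n] _].
  by exists nu; [exact: rect_cauchy_symmetric nuE|exact: rect_power1].
have t1 : 0 < t / n.+2%:R by rewrite divr_gt0.
have [nu1 nu1E] := exists_rect_cauchy_law t1.
exists nu1; first exact: rect_cauchy_symmetric nu1E.
by apply: (rect_power_cauchy t1 nu1E); rewrite mulrC divfK.
Qed.

Lemma is_rect_levy_measure_cauchy (t : R) (nu : realLaw R) (G : finiteMeasureR R) :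
  0 < t -> has_density nu (rect_cauchy_pdf lambda t) ->
  has_density G (cauchy_levy_pdf t) -> is_rect_levy_measure lambda nu G.
Proof.
move=> t0 nuE GE; split; [exact: rect_infdiv_cauchy nuE|exact: cauchy_levy_symmetric GE|].
apply: (rect_R_transform_rect_cauchy l01 t0 nuE) => alpha al.
have [beta be0 H] := sector_sqrtc al ltr01.
exists beta => // z /H[w0 w1]; exact: cauchy_levy_transform.
Qed.

End InfiniteDivisibility.

Unset Implicit Arguments.

Theorem proposition4p8 (R : realType) (lambda t : R) :
  0 <= lambda <= 1 -> 0 < t ->
  forall mu : realLaw R, has_density mu (cauchy_pdf t) ->
  exists nu : realLaw R,
    [/\ has_density nu (rect_cauchy_pdf lambda t),
        rect_bercovici_pata lambda mu nu &
        measure_support nu =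
          ~` `](- (t * (1 - lambda) / 2)), (t * (1 - lambda) / 2)[].
Proof.
move=> l01 t0 mu muE; have /andP[l0 l1] := l01.
have [nu nuE] := exists_rect_cauchy_law l01 t0.
have [G GE] := exists_cauchy_levy_measure t0.
exists nu; split=> //.
- exists G; first exact: (is_levy_measure_cauchy t0 GE muE).
  exact: is_rect_levy_measure_cauchy nuE GE.
- rewrite rect_cauchy_pdfE in nuE; apply: gap_law_support nuE.
  + by rewrite divr_ge0// mulr_ge0 ?subr_ge0// ltW.
  + by rewrite divr_gt0// mulr_gt0// ltr_pwDl.
  + have := mulr_ge0 (ltW t0) l0; lra.
Qed.
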